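(* Let $p$ be an odd prime and let $\mathcal{O}$ be a complete discrete valuation ring of characteristic zero with residue field $k$ of characteristic $p$, and assume that $\mathcal{O}$ contains a primitive $4p$-th root of unity. Let $G=(C_p\times C_p)\rtimes Q_8$, where, writing $C_p\times C_p=\langle g\rangle\times\langle h\rangle$ and $Q_8=\langle s,t\ |\ s^4=1,\ s^2=t^2,\ sts^3=t^3\rangle$, the action is given by $sgs^{-1}=g^{-1}$, $shs^{-1}=h$, $tgt^{-1}=g$, $tht^{-1}=h^{-1}$. Let $B_1$ be the nonprincipal block of $\mathcal{O}G$. Then the $\mathcal{O}$-algebra $$\hat A = \mathcal{O}\langle \gamma,\delta\ |\ \gamma\delta+\delta\gamma=0,\ f_p(\gamma)=0=f_p(\delta)\rangle$$ is a basic algebra of $B_1$. In particular, we have $k\otimes_{\mathcal{O}}\hat A\cong A$, where $A=k\langle x,y\ |\ x^p=y^p=0,\ xy+yx=0\rangle$.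
   Context: For $n\geq 0$, $T_n\in\mathbb{Z}[u]$ is the Chebyshev polynomial of the first kind, i.e. the unique polynomial of degree $n$ with $T_n(\cos\theta)=\cos(n\theta)$ for all $\theta\in\mathbb{R}$, and $f_n(u)=2T_n(\frac{u}{2})$, which is a monic polynomial in $\mathbb{Z}[u]$ for $n\ge 1$. The group algebra $\mathcal{O}G$ has exactly two blocks: with $z=s^2=t^2$ the central involution of $G$, the principal block is $\mathcal{O}G\cdot\frac12(1+z)$ and the nonprincipal block is $B_1=\mathcal{O}G\cdot\frac12(1-z)$. A basic algebra of $B_1$ is an $\mathcal{O}$-algebra Morita equivalent to $B_1$ whose quotient by its Jacobson radical is a direct product of division algebras (here, of copies of $k$). *)

(* Defs.v *)
From HB Require Import structures.
From mathcomp Require Import all_boot all_order all_algebra.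
From mathcomp Require Import all_fingroup all_solvable.
From mathcomp Require Import finmap generic_quotient boolp reals trigo.
From mathcomp.multinomials Require Import xfinmap monalg.

Set Implicit Arguments.
Unset Strict Implicit.
Unset Printing Implicit Defensive.

Import Order.TTheory GRing.Theory Num.Theory BigEnoughFSet.

Local Open Scope ring_scope.
Local Open Scope quotient_scope.

(* -------------------------------------------------------------------- *)
(* MathComp's [algType] excludes the zero ring, so that an algebra given  *)
(* by generators and relations could not be declared as one before it is  *)
(* known to be nonzero.  [pzAlgType R] is the type of associative unital  *)
(* R-algebras, possibly zero: rings with a central morphism from R.       *)

HB.mixin Record PzRing_isPzAlgebra (R : pzRingType) A of GRing.PzRing A := {
  algmap : {rmorphism R -> A};
  algmapC : forall (a : R) (x : A), algmap a * x = x * algmap a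
}.

#[short(type="pzAlgType")]
HB.structure Definition PzAlgebra (R : pzRingType) :=
  {A of GRing.PzRing A & PzRing_isPzAlgebra R A}.

Arguments algmap {R s} : rename.

Definition alg_morphism (R : pzRingType) (A B : pzAlgType R)
    (f : {rmorphism A -> B}) : Prop :=
  forall a : R, f (algmap a) = algmap a.

Definition alg_iso (R : pzRingType) (A B : pzAlgType R) : Prop :=
  exists f : {rmorphism A -> B}, alg_morphism f /\ bijective f.

(* A is isomorphic to the finite product algebra \prod_i D i: the joint   *)
(* map (f i)_i is bijective.                                              *)
Definition alg_iso_prod (R : pzRingType) (A : pzAlgType R) (I : finType)
    (D : I -> pzAlgType R) : Prop :=
  exists f : forall i : I, {rmorphism A -> D i},
    (forall i, alg_morphism (f i)) /\
    (forall d : forall i : I, D i, exists! a : A, forall i, f i a = d i).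

Definition division_algebra (R : pzRingType) (D : pzAlgType R) : Prop :=
  (1 != 0 :> D) /\
  (forall x : D, x != 0 -> exists y : D, x * y = 1 /\ y * x = 1).

(* -------------------------------------------------------------------- *)

Section QuotAlg.
Variables (R : pzRingType) (A : pzAlgType R).

Definition two_sided_ideal (I : A -> Prop) : Prop :=
  [/\ I 0, forall x y, I x -> I y -> I (x + y) &
      forall a x b, I x -> I (a * x * b)].

Definition ideal_gen (S : A -> Prop) (x : A) : Prop :=
  forall I, two_sided_ideal I -> (forall y, S y -> I y) -> I x.

Variable S : A -> Prop.

Lemma ideal_genP : two_sided_ideal (ideal_gen S).
Proof.
split=> [I [] //|x y Ix Iy I hI SI|a x b Ix I hI SI].
  by case: (hI) => _ + _; apply; [apply: Ix | apply: Iy].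
by case: (hI) => _ _; apply; apply: Ix.
Qed.

Lemma ideal_gen_sub x : S x -> ideal_gen S x.
Proof. by move=> Sx I _; apply. Qed.

Lemma ideal_gen0 : ideal_gen S 0. Proof. by case: ideal_genP. Qed.

Lemma ideal_genD x y : ideal_gen S x -> ideal_gen S y -> ideal_gen S (x + y).
Proof. by case: ideal_genP => _ + _; apply. Qed.

Lemma ideal_genMl a x : ideal_gen S x -> ideal_gen S (a * x).
Proof. by case: ideal_genP => _ _ h Ix; rewrite -[_ * _]mulr1; apply: h. Qed.

Lemma ideal_genMr a x : ideal_gen S x -> ideal_gen S (x * a).
Proof. by case: ideal_genP => _ _ h Ix; rewrite -[x]mul1r; apply: h. Qed.

Lemma ideal_genN x : ideal_gen S x -> ideal_gen S (- x).
Proof. by rewrite -mulN1r; apply: ideal_genMl. Qed.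

Definition quot_equiv (x y : A) : bool := `[< ideal_gen S (x - y) >].

Lemma quot_equiv_is_equiv : equiv_class_of quot_equiv.
Proof.
split=> [x|x y|y x z]; rewrite /quot_equiv.
- by apply/asboolP; rewrite subrr; apply: ideal_gen0.
- by apply: asbool_equiv_eq; split=> /ideal_genN; rewrite opprB.
- move=> /asboolP xy /asboolP yz; apply/asboolP.
  by rewrite -[x](subrK y) -addrA; apply: ideal_genD.
Qed.

Canonical quot_equiv_equiv := EquivRelPack quot_equiv_is_equiv.
Canonical quot_equiv_encModRel := defaultEncModRel quot_equiv.

Definition quot_alg := {eq_quot quot_equiv}.

HB.instance Definition _ : EqQuotient A quot_equiv quot_alg :=
  EqQuotient.on quot_alg.
HB.instance Definition _ := Choice.on quot_alg.

Definition quot_pi (x : A) : quot_alg := \pi_quot_alg x.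

Lemma quot_piP x y : quot_pi x = quot_pi y <-> ideal_gen S (x - y).
Proof.
split=> [/eqP|h]; last apply/eqP.
  by rewrite /quot_pi eqmodE => /asboolP.
by rewrite /quot_pi eqmodE; apply/asboolP.
Qed.

Lemma quot_piK (q : quot_alg) : quot_pi (repr q) = q.
Proof. exact: reprK. Qed.

Lemma quot_piW (P : quot_alg -> Prop) : (forall x, P (quot_pi x)) -> forall q, P q.
Proof. by move=> h q; rewrite -[q]quot_piK. Qed.

Lemma quot_repr x : ideal_gen S (repr (quot_pi x) - x).
Proof. by apply/quot_piP; rewrite quot_piK. Qed.

Definition quot_add (q r : quot_alg) := quot_pi (repr q + repr r).
Definition quot_opp (q : quot_alg) := quot_pi (- repr q).
Definition quot_mul (q r : quot_alg) := quot_pi (repr q * repr r).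

Lemma quot_piD x y : quot_add (quot_pi x) (quot_pi y) = quot_pi (x + y).
Proof.
apply/quot_piP; rewrite opprD addrACA.
by apply: ideal_genD; exact: quot_repr.
Qed.

Lemma quot_piN x : quot_opp (quot_pi x) = quot_pi (- x).
Proof. by apply/quot_piP; rewrite -opprD; apply: ideal_genN; exact: quot_repr. Qed.

Lemma quot_piM x y : quot_mul (quot_pi x) (quot_pi y) = quot_pi (x * y).
Proof.
apply/quot_piP; set x' := repr _; set y' := repr _.
rewrite -[x' * y'](subrK (x * y')) -mulrBl -addrA -mulrBr.
apply: ideal_genD; [apply: ideal_genMr | apply: ideal_genMl];
exact: quot_repr.
Qed.

Let piE := (quot_piD, quot_piN, quot_piM).

Lemma quot_addA : associative quot_add.
Proof. by do 3!elim/quot_piW=> ?; rewrite !piE addrA. Qed.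
Lemma quot_addC : commutative quot_add.
Proof. by do 2!elim/quot_piW=> ?; rewrite !piE addrC. Qed.
Lemma quot_add0 : left_id (quot_pi 0) quot_add.
Proof. by elim/quot_piW=> ?; rewrite !piE add0r. Qed.
Lemma quot_addN : left_inverse (quot_pi 0) quot_opp quot_add.
Proof. by elim/quot_piW=> ?; rewrite !piE addNr. Qed.

HB.instance Definition _ :=
  GRing.isZmodule.Build quot_alg quot_addA quot_addC quot_add0 quot_addN.

Lemma quot_mulA : associative quot_mul.
Proof. by do 3!elim/quot_piW=> ?; rewrite !piE mulrA. Qed.
Lemma quot_mul1l : left_id (quot_pi 1) quot_mul.
Proof. by elim/quot_piW=> ?; rewrite !piE mul1r. Qed.
Lemma quot_mul1r : right_id (quot_pi 1) quot_mul.
Proof. by elim/quot_piW=> ?; rewrite !piE mulr1. Qed.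
Lemma quot_mulDl : left_distributive quot_mul quot_add.
Proof. by do 3!elim/quot_piW=> ?; rewrite !piE mulrDl. Qed.
Lemma quot_mulDr : right_distributive quot_mul quot_add.
Proof. by do 3!elim/quot_piW=> ?; rewrite !piE mulrDr. Qed.

HB.instance Definition _ := GRing.Zmodule_isPzRing.Build quot_alg
  quot_mulA quot_mul1l quot_mul1r quot_mulDl quot_mulDr.

Lemma quot_pi_zmod : zmod_morphism quot_pi.
Proof. by move=> x y; rewrite -quot_piD -quot_piN. Qed.

Lemma quot_pi_monoid : monoid_morphism quot_pi.
Proof. by split=> // x y; rewrite -quot_piM. Qed.

HB.instance Definition _ :=
  GRing.isZmodMorphism.Build A quot_alg quot_pi quot_pi_zmod.
HB.instance Definition _ :=
  GRing.isMonoidMorphism.Build A quot_alg quot_pi quot_pi_monoid.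

Definition quot_algmap : {rmorphism R -> quot_alg} := quot_pi \o algmap.

Lemma quot_algmapC a (q : quot_alg) : quot_algmap a * q = q * quot_algmap a.
Proof. by elim/quot_piW: q => x; rewrite /= -!rmorphM algmapC. Qed.

HB.instance Definition _ :=
  PzRing_isPzAlgebra.Build R quot_alg quot_algmapC.

End QuotAlg.

(* -------------------------------------------------------------------- *)

Section Jacobson.
Variable A : pzRingType.

Definition left_ideal (I : A -> Prop) : Prop :=
  [/\ I 0, forall x y, I x -> I y -> I (x + y) & forall a x, I x -> I (a * x)].

Definition maximal_left_ideal (I : A -> Prop) : Prop :=
  [/\ left_ideal I, ~ I 1 &
      forall J : A -> Prop, left_ideal J -> (forall x, I x -> J x) ->
        ~ J 1 -> forall x, J x -> I x].

Definition jacobson (x : A) : Prop :=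
  forall I, maximal_left_ideal I -> I x.

End Jacobson.

(* -------------------------------------------------------------------- *)
(* The monoid algebra R[M]: finitely supported functions M -> R with the  *)
(* convolution product.  (The ring structure that the multinomials        *)
(* library puts on {malg R[K]} requires x y = 1 -> x = y = 1 in K, which  *)
(* excludes groups.)                                                      *)

Definition monoid_alg (R : comNzRingType) (M : monoidType) : Type :=
  {malg R[M]}.

Section MonoidAlg.
Variables (R : comNzRingType) (M : monoidType).

HB.instance Definition _ := GRing.Lmodule.copy (monoid_alg R M) {malg R[M]}.

Local Notation T := (monoid_alg R M).
Implicit Types (g : T) (m : M).

Definition mon_mul g1 g2 : T :=
  \sum_(m1 <- msupp g1) \sum_(m2 <- msupp g2)
    << g1@_m1 * g2@_m2 *g (m1 * m2)%g >>.

Lemma mon_mulw (d1 d2 : {fset M}) g1 g2 :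
  (msupp g1 `<=` d1)%fset -> (msupp g2 `<=` d2)%fset ->
  mon_mul g1 g2 = \sum_(m1 <- d1) \sum_(m2 <- d2)
    << g1@_m1 * g2@_m2 *g (m1 * m2)%g >>.
Proof.
move=> le_d1 le_d2; rewrite /mon_mul (big_fset_incl _ le_d1) /=.
  apply/eq_bigr=> k1 _; apply/big_fset_incl => // k _ /mcoeff_outdom ->.
  by rewrite mulr0 monalgU0.
move=> k _ /mcoeff_outdom g1k.
by rewrite big1 => // k' _; rewrite g1k mul0r monalgU0.
Qed.

Lemma mon_mulDl : left_distributive mon_mul +%R.
Proof.
move=> g1 g2 g.
have le := fsubset_refl (msupp g).
have leD : (msupp (g1 + g2 : T) `<=` msupp g1 `|` msupp g2)%fset.
  exact: msuppD_le.
rewrite (mon_mulw (fsubsetUl (msupp g1) (msupp g2)) le).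
rewrite (mon_mulw (fsubsetUr (msupp g1) (msupp g2)) le).
rewrite (mon_mulw leD le) -big_split /=.
apply/eq_bigr=> k1 _; rewrite -big_split /=; apply/eq_bigr=> k2 _.
by rewrite mcoeffD mulrDl monalgUD.
Qed.

Lemma mon_mulDr : right_distributive mon_mul +%R.
Proof.
move=> g g1 g2.
have le := fsubset_refl (msupp g).
have leD : (msupp (g1 + g2 : T) `<=` msupp g1 `|` msupp g2)%fset.
  exact: msuppD_le.
rewrite (mon_mulw le (fsubsetUl (msupp g1) (msupp g2))).
rewrite (mon_mulw le (fsubsetUr (msupp g1) (msupp g2))).
rewrite (mon_mulw le leD) -big_split /=.
apply/eq_bigr=> k1 _; rewrite -big_split /=; apply/eq_bigr=> k2 _.
by rewrite mcoeffD mulrDr monalgUD.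
Qed.

Lemma mon_mul0g : left_zero 0 mon_mul.
Proof. by move=> g; rewrite /mon_mul msupp0 big_seq_fset0. Qed.

Lemma mon_mulg0 : right_zero 0 mon_mul.
Proof.
by move=> g; rewrite /mon_mul big1 // => k _; rewrite msupp0 big_seq_fset0.
Qed.

Lemma mon_mulUU c1 c2 m1 m2 :
  mon_mul << c1 *g m1 >> << c2 *g m2 >> = << c1 * c2 *g (m1 * m2)%g >>.
Proof. by rewrite (mon_mulw msuppU_le msuppU_le) !big_seq_fset1 !mcoeffUU. Qed.

Lemma mon_mul_suml (I : Type) (r : seq I) (F : I -> T) g :
  mon_mul (\sum_(i <- r) F i) g = \sum_(i <- r) mon_mul (F i) g.
Proof.
exact: (big_morph (mon_mul^~ _) (fun _ _ => mon_mulDl _ _ _) (mon_mul0g _)).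
Qed.

Lemma mon_mul_sumr (I : Type) (r : seq I) (F : I -> T) g :
  mon_mul g (\sum_(i <- r) F i) = \sum_(i <- r) mon_mul g (F i).
Proof.
exact: (big_morph (mon_mul _) (fun _ _ => mon_mulDr _ _ _) (mon_mulg0 _)).
Qed.

Lemma mon_algE g : g = \sum_(m <- msupp g) << g@_m *g m >>.
Proof. exact: monalgE. Qed.

Lemma mon_algW (P : T -> Prop) :
  P 0 -> (forall x y, P x -> P y -> P (x + y)) ->
  (forall c m, P << c *g m >>) -> forall g, P g.
Proof.
by move=> P0 PD PU g; rewrite [g]mon_algE; apply: (big_ind P) => // m _.
Qed.

Lemma mon_mulA : associative mon_mul.
Proof.
move=> g1 g2 g3; elim/mon_algW: g1 => [|x y IHx IHy|c1 m1].
- by rewrite !mon_mul0g.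
- by rewrite !mon_mulDl IHx IHy.
elim/mon_algW: g2 => [|x y IHx IHy|c2 m2].
- by rewrite mon_mul0g !mon_mulg0 mon_mul0g.
- by rewrite mon_mulDl !mon_mulDr mon_mulDl IHx IHy.
elim/mon_algW: g3 => [|x y IHx IHy|c3 m3].
- by rewrite !mon_mulg0.
- by rewrite !mon_mulDr IHx IHy.
by rewrite !mon_mulUU mulrA mulgA.
Qed.

Lemma mon_mul1l : left_id << 1%g >> mon_mul.
Proof.
move=> g; rewrite {1}[g]mon_algE mon_mul_sumr [RHS]mon_algE.
by apply/eq_bigr=> m _; rewrite mon_mulUU mul1r mul1g.
Qed.

Lemma mon_mul1r : right_id << 1%g >> mon_mul.
Proof.
move=> g; rewrite {1}[g]mon_algE mon_mul_suml [RHS]mon_algE.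
by apply/eq_bigr=> m _; rewrite mon_mulUU mulr1 mulg1.
Qed.

Lemma mon_oner_neq0 : << 1%g >> != 0 :> T.
Proof. by rewrite monalgU_eq0 oner_eq0. Qed.

HB.instance Definition _ := GRing.Zmodule_isNzRing.Build T
  mon_mulA mon_mul1l mon_mul1r mon_mulDl mon_mulDr mon_oner_neq0.

Definition mon_elt (m : M) : T := << m >>.

Definition mon_const (a : R) : T := << a *g 1%g >>.

Lemma mon_constZ a g : mon_const a * g = a *: g.
Proof.
elim/mon_algW: g => [|x y IHx IHy|c m].
- by rewrite mulr0 scaler0.
- by rewrite mulrDr scalerDr IHx IHy.
rewrite [LHS]mon_mulUU mul1g; apply/malgP=> m'.
by rewrite [RHS]mcoeffZ !mcoeffU mulrnAr.
Qed.

Lemma mon_const_zmod : zmod_morphism mon_const.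
Proof. by move=> a b; rewrite /mon_const -monalgUB. Qed.

Lemma mon_const_monoid : monoid_morphism mon_const.
Proof. by split=> // a b; rewrite [RHS]mon_mulUU mul1g. Qed.

HB.instance Definition _ :=
  GRing.isZmodMorphism.Build R T mon_const mon_const_zmod.
HB.instance Definition _ :=
  GRing.isMonoidMorphism.Build R T mon_const mon_const_monoid.

Lemma mon_constC a g : mon_const a * g = g * mon_const a.
Proof.
elim/mon_algW: g => [|x y IHx IHy|c m].
- by rewrite mulr0 mul0r.
- by rewrite mulrDr mulrDl IHx IHy.
by rewrite [LHS]mon_mulUU [RHS]mon_mulUU mul1g mulg1 mulrC.
Qed.

HB.instance Definition _ := PzRing_isPzAlgebra.Build R T mon_constC.

Lemma mon_scaleAl a g1 g2 : a *: (g1 * g2) = (a *: g1) * g2.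
Proof. by rewrite -!mon_constZ mulrA. Qed.

HB.instance Definition _ := GRing.Lmodule_isLalgebra.Build R T mon_scaleAl.

Lemma mon_scaleAr a g1 g2 : a *: (g1 * g2) = g1 * (a *: g2).
Proof. by rewrite -!mon_constZ !mulrA (mon_constC a g1). Qed.

HB.instance Definition _ := GRing.Lalgebra_isAlgebra.Build R T mon_scaleAr.

Lemma mon_eltM m1 m2 : mon_elt (m1 * m2)%g = mon_elt m1 * mon_elt m2.
Proof. by rewrite /mon_elt [RHS]mon_mulUU mulr1. Qed.

Lemma mon_elt1 : mon_elt 1%g = 1.
Proof. by []. Qed.

End MonoidAlg.

Arguments mon_elt {R M} m.

(* -------------------------------------------------------------------- *)

Definition group_alg (R : comNzRingType) (gT : finGroupType) :=
  monoid_alg R gT.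

Definition words (I : choiceType) : Type := seq I.

HB.instance Definition _ (I : choiceType) := Choice.on (words I).
HB.instance Definition _ (I : choiceType) :=
  isMonoid.Build (words I) (@catA I) (@cat0s I) (@cats0 I).

Definition free_alg (R : comNzRingType) (I : choiceType) :=
  monoid_alg R (words I).

Definition free_var (R : comNzRingType) (I : choiceType) (i : I) :
  free_alg R I := mon_elt ([:: i] : words I).

Definition mulmon (A : pzRingType) : Type := A.

HB.instance Definition _ (A : pzRingType) := Choice.on (mulmon A).
HB.instance Definition _ (A : pzRingType) :=
  isMonoid.Build (mulmon A) (@mulrA A) (@mul1r A) (@mulr1 A).

(* -------------------------------------------------------------------- *)

Section ChangeOfRings.
Variables (R S : comNzRingType) (phi : {rmorphism R -> S}).

Definition symbol (A : pzRingType) (x : A) : monoid_alg S (mulmon A) :=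
  mon_elt (x : mulmon A).

(* The tensor product S \otimes_R A: the free S-module on the symbols     *)
(* [symbol x] = 1 \otimes x, modulo R-bilinearity, with the product       *)
(* (c \otimes x) (d \otimes y) = c d \otimes x y.  The submodule spanned   *)
(* by the bilinearity relations is already an ideal for this product.     *)
Inductive tensor_rel (A : pzAlgType R) : monoid_alg S (mulmon A) -> Prop :=
| TensorAdd (x y : A) : tensor_rel (symbol (x + y) - symbol x - symbol y)
| TensorScale (a : R) (x : A) :
    tensor_rel (symbol (algmap a * x) - phi a *: symbol x).

Definition tensor_alg (A : pzAlgType R) : pzAlgType S :=
  quot_alg (@tensor_rel A).

End ChangeOfRings.

Definition restrict (R S : comNzRingType) (phi : {rmorphism R -> S}) : Type := S.

Section RestrictScalars.
Variables (R S : comNzRingType) (phi : {rmorphism R -> S}).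

HB.instance Definition _ := GRing.ComNzRing.copy (restrict phi) S.

Definition restrict_algmap : {rmorphism R -> restrict phi} := phi.

Lemma restrict_algmapC (a : R) (x : restrict phi) :
  restrict_algmap a * x = x * restrict_algmap a.
Proof. exact: mulrC. Qed.

HB.instance Definition _ :=
  PzRing_isPzAlgebra.Build R (restrict phi) restrict_algmapC.

End RestrictScalars.

(* -------------------------------------------------------------------- *)
(* The algebra A e, with unit e, for a central idempotent e of A.         *)

Section BlockAlg.
Variables (R : pzRingType) (A : pzAlgType R) (e : A).

Definition central_idempotent : Prop :=
  e * e = e /\ (forall x : A, e * x = x * e).

Record block_alg (he : central_idempotent) : Type := Block {
  block_val : A;
  block_valP : block_val * e == block_val
}.

Variable he : central_idempotent.
Local Notation T := (block_alg he).

HB.instance Definition _ := [isSub of T for @block_val he].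
HB.instance Definition _ := [Choice of T by <:].

Let eC : forall x, e * x = x * e := he.2.
Let ee : e * e = e := he.1.

Lemma block_mem0 : (0 : A) * e == 0. Proof. by rewrite mul0r. Qed.
Lemma block_mem1 : e * e == e. Proof. by rewrite ee. Qed.
Lemma block_memD (x y : T) : (val x + val y) * e == val x + val y.
Proof. by rewrite mulrDl (eqP (valP x)) (eqP (valP y)). Qed.
Lemma block_memN (x : T) : (- val x) * e == - val x.
Proof. by rewrite mulNr (eqP (valP x)). Qed.
Lemma block_memM (x y : T) : (val x * val y) * e == val x * val y.
Proof. by rewrite -mulrA (eqP (valP y)). Qed.
Lemma block_mem_proj (x : A) : (x * e) * e == x * e.
Proof. by rewrite -mulrA ee. Qed.

Definition block_proj (x : A) : T := Block he (block_mem_proj x).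
Definition block_add (x y : T) : T := Block he (block_memD x y).
Definition block_opp (x : T) : T := Block he (block_memN x).
Definition block_mul (x y : T) : T := Block he (block_memM x y).

Lemma block_addA : associative block_add.
Proof. by move=> x y z; apply: val_inj; rewrite /= addrA. Qed.
Lemma block_addC : commutative block_add.
Proof. by move=> x y; apply: val_inj; rewrite /= addrC. Qed.
Lemma block_add0 : left_id (Block he block_mem0) block_add.
Proof. by move=> x; apply: val_inj; rewrite /= add0r. Qed.
Lemma block_addN : left_inverse (Block he block_mem0) block_opp block_add.
Proof. by move=> x; apply: val_inj; rewrite /= addNr. Qed.

HB.instance Definition _ :=
  GRing.isZmodule.Build T block_addA block_addC block_add0 block_addN.

Lemma block_mulA : associative block_mul.
Proof. by move=> x y z; apply: val_inj; rewrite /= mulrA. Qed.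
Lemma block_mul1l : left_id (Block he block_mem1) block_mul.
Proof. by move=> x; apply: val_inj; rewrite /= eC (eqP (valP x)). Qed.
Lemma block_mul1r : right_id (Block he block_mem1) block_mul.
Proof. by move=> x; apply: val_inj; rewrite /= (eqP (valP x)). Qed.
Lemma block_mulDl : left_distributive block_mul block_add.
Proof. by move=> x y z; apply: val_inj; rewrite /= mulrDl. Qed.
Lemma block_mulDr : right_distributive block_mul block_add.
Proof. by move=> x y z; apply: val_inj; rewrite /= mulrDr. Qed.

HB.instance Definition _ := GRing.Zmodule_isPzRing.Build T
  block_mulA block_mul1l block_mul1r block_mulDl block_mulDr.

Definition block_algmap (a : R) : T := block_proj (algmap a).

Lemma block_algmap_zmod : zmod_morphism block_algmap.
Proof. by move=> a b; apply: val_inj; rewrite /= rmorphB mulrBl. Qed.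
Lemma block_algmap_monoid : monoid_morphism block_algmap.
Proof.
split=> [|a b]; apply: val_inj; rewrite /= ?rmorph1 ?mul1r //.
by rewrite rmorphM -!mulrA [e * (_ * _)]mulrA eC -[in RHS]mulrA ee.
Qed.

HB.instance Definition _ :=
  GRing.isZmodMorphism.Build R T block_algmap block_algmap_zmod.
HB.instance Definition _ :=
  GRing.isMonoidMorphism.Build R T block_algmap block_algmap_monoid.

Lemma block_algmapC (a : R) (x : T) : block_algmap a * x = x * block_algmap a.
Proof.
by apply: val_inj; rewrite /= -mulrA eC (eqP (valP x)) mulrA -algmapC -mulrA
  (eqP (valP x)).
Qed.

HB.instance Definition _ := PzRing_isPzAlgebra.Build R T block_algmapC.

End BlockAlg.

(* -------------------------------------------------------------------- *)
(* Morita equivalence: an R-linear equivalence between the categories of  *)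
(* left modules.                                                          *)

Section Morita.
Variable R : pzRingType.

Record mod_functor (A B : pzAlgType R) := ModFunctor {
  fobj :> lmodType A -> lmodType B;
  fmap : forall M N : lmodType A,
    {linear M -> N} -> {linear fobj M -> fobj N};
  fmap_ext : forall (M N : lmodType A) (f g : {linear M -> N}),
    f =1 g -> fmap f =1 fmap g;
  fmap_id : forall M : lmodType A, fmap (idfun : {linear M -> M}) =1 idfun;
  fmap_comp : forall (M N P : lmodType A)
      (g : {linear N -> P}) (f : {linear M -> N}),
    fmap (g \o f : {linear M -> P}) =1 fmap g \o fmap f;
  fmap_add : forall (M N : lmodType A) (f g h : {linear M -> N}),
    (forall x, h x = f x + g x) ->
    forall y, fmap h y = fmap f y + fmap g y;
  fmap_scale : forall (M N : lmodType A) (a : R) (f h : {linear M -> N}),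
    (forall x, h x = algmap a *: f x) ->
    forall y, fmap h y = algmap a *: fmap f y
}.

Arguments fmap_id {A B} _ M.

Definition nat_iso (A B : pzAlgType R) (F G : mod_functor A B) : Prop :=
  exists eta : forall M : lmodType A, {linear F M -> G M},
    (forall M, bijective (eta M)) /\
    (forall (M N : lmodType A) (f : {linear M -> N}) (x : F M),
       eta N (fmap F f x) = fmap G f (eta M x)).

Definition id_functor (A : pzAlgType R) : mod_functor A A.
Proof. by exists id (fun M N f => f). Defined.

Definition comp_functor (A B C : pzAlgType R)
  (G : mod_functor B C) (F : mod_functor A B) : mod_functor A C.
Proof.
exists (fun M => G (F M)) (fun M N f => fmap G (fmap F f)).
- by move=> M N f g fg; apply/fmap_ext/fmap_ext.
- by move=> M x; rewrite (fmap_ext (g := idfun) (fmap_id F M)) fmap_id.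
- by move=> M N P g f x; rewrite (fmap_ext (g := fmap F g \o fmap F f) (fmap_comp g f)) fmap_comp.
- by move=> M N f g h hE; apply/fmap_add/fmap_add.
- by move=> M N a f h hE; apply/fmap_scale/fmap_scale.
Defined.

Definition morita_equivalent (A B : pzAlgType R) : Prop :=
  exists (F : mod_functor A B) (G : mod_functor B A),
    nat_iso (comp_functor G F) (id_functor A) /\
    nat_iso (comp_functor F G) (id_functor B).

End Morita.

(* A is a basic algebra of B.  Here [quot_alg (@jacobson A)] is A / J(A):  *)
(* J(A) is a two-sided ideal, so it is the ideal that it generates.       *)
Definition basic_algebra_of (R : pzRingType) (B A : pzAlgType R) : Prop :=
  morita_equivalent B A /\
  exists (n : nat) (D : 'I_n -> pzAlgType R),
    (forall i, division_algebra (D i)) /\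
    alg_iso_prod (quot_alg (@jacobson A)) D.

(* -------------------------------------------------------------------- *)
(* Chebyshev polynomials of the first kind; [horner_chebT_cos] and        *)
(* [size_chebT] are the defining properties of T_n.                       *)

Fixpoint chebT (n : nat) : {poly int} :=
  if n is m.+1 then
    if m is l.+1 then 2 *: 'X * chebT m - chebT l else 'X
  else 1.

Lemma chebTSS n : chebT n.+2 = 2 *: 'X * chebT n.+1 - chebT n.
Proof. by []. Qed.

Lemma size_chebT n : size (chebT n) = n.+1.
Proof.
suff: size (chebT n) = n.+1 /\ size (chebT n.+1) = n.+2 by case.
elim: n => [|n [IH1 IH2]]; first by rewrite size_poly1 size_polyX.
split=> //; rewrite chebTSS -scalerAl size_polyDl size_scale //.
  by rewrite mulrC size_mulX ?IH2 // -size_poly_eq0 IH2.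
by rewrite size_polyN IH1 mulrC size_mulX ?IH2 // -size_poly_eq0 IH2.
Qed.

Lemma horner_chebT_cos (R : realType) n (x : R) :
  (map_poly intr (chebT n)).[cos x] = cos (n%:R * x).
Proof.
pose T m := (map_poly intr (chebT m)).[cos x].
suff: T n = cos (n%:R * x) /\ T n.+1 = cos (n.+1%:R * x) by case.
elim: n => [|n [IH1 IH2]].
  by rewrite /T /= rmorph1 hornerC map_polyX hornerX mul0r cos0 mul1r.
split=> //; rewrite /T chebTSS rmorphB rmorphM /= map_polyZ map_polyX.
rewrite hornerD hornerN hornerM hornerZ hornerX -/(T n.+1) -/(T n) IH1 IH2.
have -> : n.+2%:R * x = n.+1%:R * x + x by rewrite -natr1 mulrDl mul1r.
have -> : n%:R * x = n.+1%:R * x - x by rewrite -natr1 mulrDl mul1r addrK.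
rewrite cosB cosD opprD addrA.
by rewrite rmorph_nat -mulrA [cos x * _]mulrC mulrDl mul1r addrK.
Qed.

(* f_n(u) = 2 T_n(u/2), computed over the rationals. *)
Definition cheb_f_rat (n : nat) : {poly rat} :=
  2 *: (map_poly intr (chebT n) \Po (2^-1 *: 'X)).

(* The same polynomial in Z[u]: the coefficients of [cheb_f_rat n] are    *)
(* integers by [cheb_fE], so that taking numerators loses nothing.        *)
Definition cheb_f (n : nat) : {poly int} := map_poly numq (cheb_f_rat n).

Lemma cheb_f_ratSS n :
  cheb_f_rat n.+2 = 'X * cheb_f_rat n.+1 - cheb_f_rat n.
Proof.
rewrite /cheb_f_rat chebTSS rmorphB rmorphM /= map_polyZ map_polyX.
rewrite comp_polyB comp_polyM comp_polyZ comp_polyX scalerBr.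
by rewrite scalerA mulfV // scale1r -scalerAr.
Qed.

Lemma cheb_fE n : map_poly intr (cheb_f n) = cheb_f_rat n.
Proof.
have int_f m : exists F : {poly int}, cheb_f_rat m = map_poly intr F.
  suff: (exists F, cheb_f_rat m = map_poly intr F) /\
        (exists F, cheb_f_rat m.+1 = map_poly intr F) by case.
  elim: m => [|m [[F1 IH1] [F2 IH2]]]; split.
  - exists 2%:P; rewrite /cheb_f_rat /= rmorph1 comp_polyC map_polyC.
    by rewrite -mul_polyC mulr1.
  - exists 'X; rewrite /cheb_f_rat /= map_polyX comp_polyX scalerA mulfV //.
    by rewrite scale1r.
  - by exists F2.
  - exists ('X * F2 - F1).
    by rewrite cheb_f_ratSS IH1 IH2 rmorphB rmorphM /= map_polyX.
have [F FE] := int_f n; rewrite /cheb_f FE; congr map_poly.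
by apply/polyP=> i; rewrite coef_map_id0 // coef_map /= numq_int.
Qed.

Lemma cheb_fSS n : cheb_f n.+2 = 'X * cheb_f n.+1 - cheb_f n.
Proof.
apply: (@map_inj_poly _ _ (intr : int -> rat)) => //; first exact: intr_inj.
by rewrite rmorphB rmorphM /= map_polyX !cheb_fE cheb_f_ratSS.
Qed.

(* -------------------------------------------------------------------- *)

Section Presentations.
Variables (R : comNzRingType) (p : nat).

Local Notation F := (free_alg R 'I_2).
Local Notation X := (free_var R (ord0 : 'I_2)).
Local Notation Y := (free_var R (ord_max : 'I_2)).

(* R< X, Y | X Y + Y X = 0, f_p(X) = 0 = f_p(Y) > *)
Inductive hatA_rel : F -> Prop :=
| HatA_anticomm : hatA_rel (X * Y + Y * X)
| HatA_chebX : hatA_rel (map_poly intr (cheb_f p)).[X]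
| HatA_chebY : hatA_rel (map_poly intr (cheb_f p)).[Y].

Definition hatA : pzAlgType R := quot_alg hatA_rel.

(* R< X, Y | X^p = Y^p = 0, X Y + Y X = 0 > *)
Inductive algA_rel : F -> Prop :=
| AlgA_powX : algA_rel (X ^+ p)
| AlgA_powY : algA_rel (Y ^+ p)
| AlgA_anticomm : algA_rel (X * Y + Y * X).

Definition algA : pzAlgType R := quot_alg algA_rel.

End Presentations.

(* -------------------------------------------------------------------- *)

Section DiscreteValuationRing.
Variable O : idomainType.

Definition uniformizer (pi : O) : Prop :=
  [/\ pi != 0, pi \isn't a GRing.unit &
      forall x : O, x != 0 ->
        exists (n : nat) (u : O), u \is a GRing.unit /\ x = u * pi ^+ n].

Definition discrete_valuation_ring : Prop := exists pi, uniformizer pi.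

Definition adic_congr (pi : O) (n : nat) (x y : O) : Prop :=
  exists c : O, x - y = c * pi ^+ n.

(* Separatedness of the adic topology is automatic in a discrete          *)
(* valuation ring.                                                        *)
Definition adically_complete (pi : O) : Prop :=
  forall x : nat -> O,
    (forall n, exists N, forall i j, (N <= i)%N -> (N <= j)%N ->
       adic_congr pi n (x i) (x j)) ->
    exists l : O, forall n, exists N, forall i, (N <= i)%N ->
       adic_congr pi n (x i) l.

Definition complete_dvr : Prop :=
  discrete_valuation_ring /\
  (forall pi, uniformizer pi -> adically_complete pi).

(* res exhibits k as the quotient of the local ring O by its maximal      *)
(* ideal.                                                                 *)
Definition residue_map (k : fieldType) (res : {rmorphism O -> k}) : Prop :=
  (forall y : k, exists x : O, res x = y) /\
  (forall x : O, res x = 0 <-> x \isn't a GRing.unit).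

Lemma residue_unit2 (k : fieldType) (res : {rmorphism O -> k}) (p : nat) :
  residue_map res -> p \in [pchar k] -> odd p -> (2 : O) \is a GRing.unit.
Proof.
move=> [_ resP] chk p_odd; apply/negPn/negP => /resP/eqP.
rewrite rmorph_nat -(dvdn_pcharf chk) dvdn_prime2 ?(pcharf_prime chk) //.
by move=> /eqP pE; rewrite pE in p_odd.
Qed.

End DiscreteValuationRing.

(* -------------------------------------------------------------------- *)
(* gT is the internal semidirect product (<g> x <h>) ><| <s, t>.          *)

Record CpCp_Q8 (p : nat) (gT : finGroupType) (g h s t : gT) : Prop := {
  CpCpQ8_order_g : #[g]%g = p;
  CpCpQ8_order_h : #[h]%g = p;
  CpCpQ8_sdprod :
    ((<[g]> \x <[h]>) ><| <<[set s; t]>> = [set: gT])%g;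
  CpCpQ8_s4 : (s ^+ 4 = 1)%g;
  CpCpQ8_s2 : (s ^+ 2 = t ^+ 2)%g;
  CpCpQ8_sts3 : (s * t * s ^+ 3 = t ^+ 3)%g;
  (* the relations above are defining relations of <s, t> *)
  CpCpQ8_pres :
    (<<[set s; t]>> \isog Grp (x : y :
       x ^+ 4, x ^+ 2 = y ^+ 2, x * y * x ^+ 3 = y ^+ 3))%g;
  CpCpQ8_sg : (s * g * s^-1 = g^-1)%g;
  CpCpQ8_sh : (s * h * s^-1 = h)%g;
  CpCpQ8_tg : (t * g * t^-1 = g)%g;
  CpCpQ8_th : (t * h * t^-1 = h^-1)%g
}.

Section NonprincipalBlock.
Variables (O : idomainType) (p : nat) (gT : finGroupType) (g h s t : gT).
Hypotheses (two_unit : (2 : O) \is a GRing.unit) (hG : CpCp_Q8 p g h s t).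

Lemma CpCp_Q8_central (x : gT) : (s ^+ 2 * x = x * s ^+ 2)%g.
Proof.
case: hG => _ _ hGd _ s2 _ _ sg sh tg th.
have commE (y z : gT) : (y * z * y^-1 = z)%g -> commute y z.
  by move=> yz; rewrite /commute -{2}yz mulgKV.
have cg : commute (s ^+ 2)%g g.
  by rewrite s2; apply/commute_sym/commuteX/commute_sym/commE.
have ch : commute (s ^+ 2)%g h by apply/commute_sym/commuteX/commute_sym/commE.
have cs : commute (s ^+ 2)%g s by apply/commute_sym/commuteX.
have ct : commute (s ^+ 2)%g t by rewrite s2; apply/commute_sym/commuteX.
suff: x \in ('C[s ^+ 2])%g by move/cent1P.
have: x \in [set: gT] by rewrite inE.
case/sdprodP: hGd => [[N Q dN _] <- _ _]; apply: subsetP.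
rewrite mul_subG //; last first.
  by rewrite gen_subG; apply/subsetP=> y /set2P[] ->; apply/cent1P.
case/dprodP: (dN) => _ eN _ _; rewrite dN -eN.
by rewrite mul_subG // cycle_subG; apply/cent1P.
Qed.

Definition nonprincipal_idem : group_alg O gT :=
  2^-1 *: (1 - mon_elt (s ^+ 2)%g).

Lemma nonprincipal_idemP : central_idempotent nonprincipal_idem.
Proof.
rewrite /nonprincipal_idem; set z := mon_elt _.
have zC x : z * x = x * z.
  elim/mon_algW: x => [|x y IHx IHy|c m].
  - by rewrite mulr0 mul0r.
  - by rewrite mulrDr mulrDl IHx IHy.
  by rewrite [LHS]mon_mulUU [RHS]mon_mulUU mulrC CpCp_Q8_central.
have zz : z * z = 1.
  by rewrite -mon_eltM -expgD (CpCpQ8_s4 hG).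
split=> [|x]; last first.
  by rewrite -scalerAl -scalerAr mulrBl mulrBr mul1r mulr1 zC.
rewrite -scalerAl -scalerAr scalerA mulrBl mul1r mulrBr mulr1 zz.
have -> : 1 - z - (z - 1) = 2 *: (1 - z).
  by rewrite scaler_nat mulr2n opprB.
by rewrite scalerA -mulrA mulVr // mulr1.
Qed.

(* O G is the direct sum of its two blocks O G (1 + z)/2 and              *)
(* O G (1 - z)/2, where z = s^2 is the central involution of G; the       *)
(* augmentation kills (1 - z)/2.                                          *)
Definition nonprincipal_block : pzAlgType O := block_alg nonprincipal_idemP.

End NonprincipalBlock.

(* Main.v *)
From HB Require Import structures.
Require Import Defs.
From mathcomp Require Import all_boot all_order all_algebra.
From mathcomp Require Import all_fingroup all_solvable.
From mathcomp Require Import finmap generic_quotient boolp.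
From mathcomp.multinomials Require Import monalg.
From mathcomp Require Import zify ring.

(** Let z = s^2 and let S, T, G, H be the images of s, t, g, h in the
    nonprincipal block B, on which z acts as -1.  Then S^2 = T^2 = -1 and
    T S = - S T.  As 2 is invertible and O contains a square root iota of -1,
    a power of the root of unity, S and T generate a copy of the 2 x 2
    matrices over O ([quat_unit]).  So B is the algebra of 2 x 2 matrices over
    the centralizer C of S and T, and it is Morita equivalent to C
    ([matrix_morita_equivalent]); the point is to identify C.

    The element G - G^-1 anticommutes with S and commutes with T, exactly as
    T does. So gamma = T (G - G^-1) is in C, and so is delta = S (H - H^-1),
    by symmetry; moreover gamma and delta anticommute. Now gamma = w + w^-1
    with w = T G, and f_p(w + w^-1) = w^p + w^-p ([cheb_f_inv_sum]), which
    is T^p + T^-p = 0 as G^p = 1 and p is odd. This gives a map from hatA to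
    C, hence one from M_2(hatA) to B. The latter is surjective
    ([hatA_matrix_epi]) because G + G^-1 is a polynomial in (G - G^-1)^2, p
    being odd ([invertible_mem]). It is injective by counting: f_p is monic,
    so hatA is spanned by the p^2 monomials gamma^i delta^j with i, j < p
    ([anticomm_coord]), and M_2(hatA) by 4 p^2 elements. Their images in B,
    with 4 p^2 obvious generators of the complementary block, span O G,
    which is free of rank |G| = 8 p^2, and a spanning family of that size is
    a basis ([spanning_free], [nonprincipal_block_morita]).

    The rest follows from f_p = 'X^p modulo p ([cheb_f_prime]).  In hatA the
    elements gamma^p and delta^p are multiples of p.  Multiples of nonunits of
    O are in the Jacobson radical because hatA is a finitely generated
    O-module and O is local ([nonunit_left_quasiregular]); and gamma and delta
    normalize hatA, so they are in the radical with their p-th powers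
    ([normal_left_quasiregular]).  Hence the quotient of hatA by its radical
    is k ([hatA_jacobson_iso]).  Over k the relations f_p = 0 become the
    vanishing of p-th powers, which identifies the reduction of hatA
    ([tensor_hatA_iso]). *)

Set Implicit Arguments.
Unset Strict Implicit.
Unset Printing Implicit Defensive.

Import GRing.Theory.

Local Open Scope ring_scope.

(** * Morphisms out of monoid algebras and presented algebras *)

Section MonoidAlgLift.
Variables (R : comNzRingType) (M : monoidType) (T : pzRingType).
Variables (rho : {rmorphism R -> T}) (mu : M -> T).
Hypothesis mu1 : mu 1%g = 1.
Hypothesis muM : forall x y, mu (x * y)%g = mu x * mu y.
Hypothesis rho_comm : forall a x, rho a * mu x = mu x * rho a.

Definition mon_lift_fun (g : monoid_alg R M) : T :=
  \sum_(m <- msupp g) rho g@_m * mu m.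

Let mon_lift_funEw (d : {fset M}) (g : monoid_alg R M) :
  (msupp g `<=` d)%fset -> mon_lift_fun g = \sum_(m <- d) rho g@_m * mu m.
Proof.
move=> le_d; apply: big_fset_incl => // m _ /mcoeff_outdom ->.
by rewrite rmorph0 mul0r.
Qed.

Lemma mon_lift_funU c m : mon_lift_fun << c *g m >> = rho c * mu m.
Proof. by rewrite (mon_lift_funEw msuppU_le) big_seq_fset1 mcoeffUU. Qed.

Lemma mon_lift_zmod : zmod_morphism mon_lift_fun.
Proof.
move=> x y; rewrite (mon_lift_funEw (msuppB_le x y)).
rewrite (mon_lift_funEw (fsubsetUl (msupp x) (msupp y))).
rewrite (mon_lift_funEw (fsubsetUr (msupp x) (msupp y))) -sumrB.
by apply: eq_bigr => m _; rewrite mcoeffB rmorphB mulrBl.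
Qed.

HB.instance Definition _ :=
  GRing.isZmodMorphism.Build (monoid_alg R M) T mon_lift_fun mon_lift_zmod.

Lemma mon_lift_monoid : monoid_morphism mon_lift_fun.
Proof.
have lift0 : mon_lift_fun 0 = 0 := raddf0 mon_lift_fun.
have liftD x y : mon_lift_fun (x + y) = mon_lift_fun x + mon_lift_fun y.
  exact: (raddfD mon_lift_fun).
split=> [|x y]; first by rewrite mon_lift_funU rmorph1 mul1r mu1.
elim/mon_algW: x => [|x x' IHx IHx'|c m]; first by rewrite mul0r lift0 mul0r.
  by rewrite mulrDl !liftD mulrDl IHx IHx'.
elim/mon_algW: y => [|y y' IHy IHy'|d l]; first by rewrite mulr0 lift0 mulr0.
  by rewrite mulrDr !liftD mulrDr IHy IHy'.
rewrite [X in mon_lift_fun X]mon_mulUU !mon_lift_funU rmorphM muM !mulrA.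
by rewrite -[rho c * rho d * mu m]mulrA rho_comm !mulrA.
Qed.

(** The universal property of a monoid algebra.  The target is any ring with a
    map from the base, and not an algebra over that base: this covers maps
    that are semilinear along a change of rings. *)
Definition mon_lift : {rmorphism monoid_alg R M -> T} :=
  HB.pack mon_lift_fun
    (GRing.isMonoidMorphism.Build _ _ mon_lift_fun mon_lift_monoid).

Lemma mon_liftU c m : mon_lift << c *g m >> = rho c * mu m.
Proof. exact: mon_lift_funU. Qed.

Lemma mon_lift_elt m : mon_lift (mon_elt m) = mu m.
Proof. by rewrite mon_liftU rmorph1 mul1r. Qed.

Lemma mon_lift_const a : mon_lift (algmap a) = rho a.
Proof. by rewrite mon_liftU mu1 mulr1. Qed.

Lemma mon_liftZ a x : mon_lift (a *: x) = rho a * mon_lift x.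
Proof. by rewrite -mon_constZ rmorphM [X in X * _]mon_lift_const. Qed.

End MonoidAlgLift.

Section FreeAlgLift.
Variables (R : comNzRingType) (I : choiceType) (T : pzRingType).
Variables (rho : {rmorphism R -> T}) (x : I -> T).
Hypothesis rho_central : forall a y, rho a * y = y * rho a.

Let word_val (w : words I) : T := \prod_(i <- w) x i.

Let word_val1 : word_val 1%g = 1. Proof. exact: big_nil. Qed.
Let word_valM v w : word_val (v * w)%g = word_val v * word_val w.
Proof. exact: big_cat. Qed.

Definition free_lift : {rmorphism free_alg R I -> T} :=
  mon_lift word_val1 word_valM (fun a w => rho_central a (word_val w)).

Lemma free_lift_var i : free_lift (free_var R i) = x i.
Proof. by rewrite [LHS]mon_lift_elt /word_val big_seq1. Qed.

Lemma free_lift_const a : free_lift (algmap a) = rho a.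
Proof. exact: mon_lift_const. Qed.

End FreeAlgLift.

Section QuotLift.
Variables (R : pzRingType) (A : pzAlgType R) (S : A -> Prop) (T : pzRingType).
Variable f : {rmorphism A -> T}.
Hypothesis fS : forall y, S y -> f y = 0.

(** The kernel of f is one of the two-sided ideals over which [ideal_gen]
    intersects. *)
Lemma ideal_gen_ker y : ideal_gen S y -> f y = 0.
Proof.
move=> Sy; apply: (Sy (fun z => f z = 0)) => //.
split=> [|a b fa fb|a b c fb]; first exact: rmorph0.
  by rewrite rmorphD fa fb addr0.
by rewrite !rmorphM fb mulr0 mul0r.
Qed.

Definition quot_lift_fun (q : quot_alg S) : T :=
  f (repr q).

Lemma quot_lift_funE y : quot_lift_fun (quot_pi S y) = f y.
Proof.
apply/eqP; rewrite -subr_eq0 -rmorphB; apply/eqP/ideal_gen_ker.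
exact: quot_repr.
Qed.

Lemma quot_lift_zmod : zmod_morphism quot_lift_fun.
Proof.
by do 2!elim/quot_piW=> ?; rewrite -rmorphB !quot_lift_funE rmorphB.
Qed.

Lemma quot_lift_monoid : monoid_morphism quot_lift_fun.
Proof.
split; first by rewrite -(rmorph1 (quot_pi S)) quot_lift_funE rmorph1.
by do 2!elim/quot_piW=> ?; rewrite -rmorphM !quot_lift_funE rmorphM.
Qed.

Definition quot_lift : {rmorphism quot_alg S -> T} :=
  HB.pack quot_lift_fun
    (GRing.isZmodMorphism.Build _ _ quot_lift_fun quot_lift_zmod)
    (GRing.isMonoidMorphism.Build _ _ quot_lift_fun quot_lift_monoid).

Lemma quot_liftE y : quot_lift (quot_pi S y) = f y.
Proof. exact: quot_lift_funE. Qed.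

End QuotLift.

Lemma quot_pi_rel (R : pzRingType) (A : pzAlgType R) (S : A -> Prop) y :
  S y -> quot_pi S y = 0.
Proof.
move=> Sy; rewrite -(rmorph0 (quot_pi S)); apply/quot_piP; rewrite subr0.
exact: ideal_gen_sub.
Qed.

Lemma quot_pi_anticomm (R : pzRingType) (A : pzAlgType R) (S : A -> Prop) x y :
  S (x * y + y * x) -> quot_pi S x * quot_pi S y = - quot_pi S y * quot_pi S x.
Proof.
by move/quot_pi_rel/eqP; rewrite rmorphD !rmorphM addr_eq0 mulNr => /eqP.
Qed.

Section Presented.
Variables (R : comNzRingType) (I : choiceType) (S : free_alg R I -> Prop).

Definition pres_var (i : I) : quot_alg S := quot_pi S (free_var R i).

(** Being generated by the classes of the variables, as an induction principle:
    an element of the free algebra is a combination of words, and a word is a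
    product of variables. *)
Lemma pres_ind (P : quot_alg S -> Prop) :
    (forall a, P (algmap a)) -> (forall i, P (pres_var i)) ->
    (forall x y, P x -> P y -> P (x + y)) ->
    (forall x y, P x -> P y -> P (x * y)) ->
  forall x, P x.
Proof.
move=> Palg Pvar PD PM; elim/quot_piW; elim/mon_algW.
- by rewrite rmorph0 -(rmorph0 algmap).
- by move=> x y; rewrite rmorphD; apply: PD.
move=> c m; have -> : (<< c *g m >> : free_alg R I) = algmap c * mon_elt m.
  by rewrite [RHS]mon_mulUU mulr1 mul1g.
rewrite rmorphM; apply: (PM); first exact: Palg.
elim: m => [|i m IHm].
  by rewrite [X in P X](rmorph1 (quot_pi S)) -(rmorph1 algmap).
rewrite -[i :: m]/((([:: i] : words I) * m)%g) mon_eltM rmorphM.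
by apply: PM; [apply: Pvar | apply: IHm].
Qed.

Lemma pres_rmorph_ext (T : pzRingType) (f f' : {rmorphism quot_alg S -> T}) :
    (forall a, f (algmap a) = f' (algmap a)) ->
    (forall i, f (pres_var i) = f' (pres_var i)) ->
  f =1 f'.
Proof.
move=> fa fv; elim/pres_ind=> // x y fx fy; first by rewrite !rmorphD fx fy.
by rewrite !rmorphM fx fy.
Qed.

End Presented.

Lemma ord2_ind (P : 'I_2 -> Prop) : P ord0 -> P ord_max -> forall i, P i.
Proof.
move=> P0 P1 i; have [->|->] // : i = ord0 \/ i = ord_max.
by case: i => -[|[|//]] i; [left|right]; apply: val_inj.
Qed.

(** The images are variables u and v so that the lemma can be applied to
    the variables of a free algebra without unfolding their product. *)
Lemma rmorph_anticomm (A T : pzRingType) (f : {rmorphism A -> T}) x y u v :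
  f x = u -> f y = v -> f (x * y + y * x) = u * v + v * u.
Proof. by move=> <- <-; rewrite rmorphD !rmorphM. Qed.

Lemma pres_ind2 (R : comNzRingType) (S : free_alg R 'I_2 -> Prop)
    (P : quot_alg S -> Prop) :
    (forall a, P (algmap a)) ->
    P (pres_var S ord0) -> P (pres_var S ord_max) ->
    (forall x y, P x -> P y -> P (x + y)) ->
    (forall x y, P x -> P y -> P (x * y)) ->
  forall x, P x.
Proof.
by move=> Pa Px Py PD PM; apply: (pres_ind Pa _ PD PM); apply: ord2_ind.
Qed.

Lemma quot_pi_pow (R : pzRingType) (A : pzAlgType R) (S : A -> Prop) x n :
  S (x ^+ n) -> quot_pi S x ^+ n = 0.
Proof. by move/quot_pi_rel; rewrite rmorphXn. Qed.

Lemma rmorph_pow (A T : pzRingType) (f : {rmorphism A -> T}) x u n :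
  f x = u -> f (x ^+ n) = u ^+ n.
Proof. by move=> <-; rewrite rmorphXn. Qed.

(** * Scalar extension as a universal construction *)

Section Tensor.
Variables (R S : comNzRingType) (phi : {rmorphism R -> S}) (A : pzAlgType R).

Local Notation rels := (@tensor_rel R S phi A).
Local Notation T := (quot_alg rels).

(** The canonical map x |-> 1 (x) x.  It is additive and semilinear by the
    defining relations, and multiplicative because the symbols multiply like
    the elements that they stand for. *)
Definition tensor_in (x : A) : T := quot_pi rels (symbol S x).

Let tensor_inD x y : tensor_in (x + y) = tensor_in x + tensor_in y.
Proof.
rewrite /tensor_in -[RHS](rmorphD (quot_pi rels)); apply/quot_piP.
by rewrite opprD addrA; apply: ideal_gen_sub; apply: TensorAdd.
Qed.

Lemma tensor_in_zmod : zmod_morphism tensor_in.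
Proof. by move=> x y; rewrite -[in RHS](subrK y x) [in RHS]tensor_inD addrK. Qed.

Lemma tensor_in_monoid : monoid_morphism tensor_in.
Proof.
split=> [|x y]; first exact: (rmorph1 (quot_pi rels)).
rewrite /tensor_in -[RHS](rmorphM (quot_pi rels)); congr (quot_pi rels _).
exact: (@mon_eltM S (mulmon A)).
Qed.

HB.instance Definition _ :=
  GRing.isZmodMorphism.Build A T tensor_in tensor_in_zmod.
HB.instance Definition _ :=
  GRing.isMonoidMorphism.Build A T tensor_in tensor_in_monoid.

Lemma tensor_in_alg a : tensor_in (algmap a) = algmap (phi a).
Proof.
apply/quot_piP; apply: ideal_gen_sub.
have := @TensorScale R S phi A a 1; rewrite mulr1 -mon_constZ.
by rewrite [symbol S 1]/(1 : monoid_alg S (mulmon A)) mulr1.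
Qed.

Lemma tensor_rmorph_ext (U : pzRingType) (f f' : {rmorphism T -> U}) :
    (forall a, f (algmap a) = f' (algmap a)) ->
    (forall x, f (tensor_in x) = f' (tensor_in x)) ->
  f =1 f'.
Proof.
move=> fa fin; elim/quot_piW; elim/mon_algW=> [|x y IHx IHy|c m].
- by rewrite !rmorph0.
- by rewrite !rmorphD IHx IHy.
have -> : (<< c *g m >> : monoid_alg S (mulmon A)) = algmap c * mon_elt m.
  by rewrite [RHS]mon_mulUU mulr1 mul1g.
by rewrite !rmorphM [X in X * _]fa [X in _ * X]fin.
Qed.

(** Together with [tensor_rmorph_ext] this characterizes the tensor product by
    its morphisms. *)
Lemma tensor_lift (U : pzAlgType S) (f : {rmorphism A -> U}) :
    (forall a, f (algmap a) = algmap (phi a)) ->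
  exists F : {rmorphism tensor_alg phi A -> U},
    alg_morphism F /\ forall x, F (tensor_in x) = f x.
Proof.
move=> f_alg.
have f1 : (f : mulmon A -> U) 1%g = 1 by exact: rmorph1.
have fM (x y : mulmon A) : (f : mulmon A -> U) (x * y)%g = f x * f y.
  exact: rmorphM.
pose F0 := mon_lift f1 fM (fun a x => algmapC a (f x)).
have F0_in x : F0 (symbol S x) = f x by exact: mon_lift_elt.
have F0Z a g : F0 (a *: g) = algmap a * F0 g by exact: mon_liftZ.
have F0_alg a : F0 (algmap a) = algmap a by exact: mon_lift_const.
clearbody F0.
have F0rel r : rels r -> F0 r = 0.
  case=> [x y|a x]; first by rewrite !rmorphB !F0_in rmorphD addrAC addrK subrr.
  by rewrite rmorphB F0Z !F0_in rmorphM f_alg subrr.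
by exists (quot_lift F0rel); split=> [a|x]; rewrite [LHS]quot_liftE.
Qed.

End Tensor.

(** * The polynomials f_n at a sum of two inverse elements *)

Lemma cheb_f0 : cheb_f 0 = 2.
Proof.
apply: (@map_inj_poly _ _ (intr : int -> rat)) => //; first exact: intr_inj.
rewrite cheb_fE /cheb_f_rat /= rmorph1 comp_polyC rmorph_nat.
by rewrite scaler_nat.
Qed.

Lemma cheb_f1 : cheb_f 1 = 'X.
Proof.
apply: (@map_inj_poly _ _ (intr : int -> rat)) => //; first exact: intr_inj.
rewrite cheb_fE /cheb_f_rat /= map_polyX comp_polyX scalerA.
by rewrite mulfV // scale1r.
Qed.

(** The recursion multiplies the leading term by 'X at each step, starting from
    f_1 = 'X. *)
Lemma size_cheb_f n : (size (cheb_f n.+1 - 'X^(n.+1))%R <= n.+1)%N.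
Proof.
suff: (size (cheb_f n.+1 - 'X^(n.+1))%R <= n.+1)%N /\
      (size (cheb_f n.+2 - 'X^(n.+2))%R <= n.+2)%N by case.
elim: n => [|n [IH1 IH2]].
  rewrite cheb_fSS cheb_f1 cheb_f0 expr1 subrr size_poly0; split=> //.
  rewrite addrAC -expr2 subrr add0r size_polyN.
  by rewrite -polyC_natr size_polyC.
split=> //; rewrite cheb_fSS exprS addrAC -mulrBr.
apply: leq_trans (size_polyD _ _) _; rewrite geq_max size_polyN.
apply/andP; split; first by apply: leq_trans (size_polyMleq _ _) _; rewrite size_polyX.
rewrite -[cheb_f _](subrK 'X^(n.+1)).
apply: leq_trans (size_polyD _ _) _; rewrite geq_max size_polyXn.
by rewrite (leq_trans IH1) ?leqnSn // -addn2 leq_addr.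
Qed.

Lemma horner_cheb_fSS (S : nzRingType) (x : S) n :
  (map_poly intr (cheb_f n.+2)).[x] =
    (map_poly intr (cheb_f n.+1)).[x] * x - (map_poly intr (cheb_f n)).[x].
Proof.
rewrite cheb_fSS rmorphB rmorphM /= map_polyX hornerD hornerN.
by rewrite -commr_polyX hornerMX.
Qed.

(** This is the identity 2 cos(n a) = e^(ina) + e^(-ina) in an arbitrary ring:
    both sides satisfy the recursion a_(n+2) = (w + w') a_(n+1) - a_n.  The
    morphism phi is there because the polynomial is evaluated in a ring with
    1 <> 0, while w and w' may live in a possibly zero ring. *)
Lemma cheb_f_inv_sum (S : nzRingType) (T : pzRingType)
    (phi : {rmorphism S -> T}) (x : S) (w w' : T) n :
    w * w' = 1 -> w' * w = 1 -> phi x = w + w' ->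
  phi (map_poly intr (cheb_f n)).[x] = w ^+ n + w' ^+ n.
Proof.
move=> ww' w'w phix; pose F m := phi (map_poly intr (cheb_f m)).[x].
suff: F n = w ^+ n + w' ^+ n /\ F n.+1 = w ^+ n.+1 + w' ^+ n.+1 by case.
elim: n => [|n [IH1 IH2]].
  rewrite /F cheb_f0 cheb_f1 map_polyX hornerX phix rmorph_nat.
  by rewrite -polyC_natr hornerC rmorph_nat.
split=> //; rewrite /F horner_cheb_fSS rmorphB rmorphM /= -/(F _) -/(F _) phix.
rewrite IH1 IH2 mulrDl !mulrDr -!exprSr.
rewrite [w ^+ n.+1]exprSr [w' ^+ n.+1]exprSr -!mulrA ww' w'w !mulr1.
by rewrite [w' ^+ n + _]addrC addrACA addrK.
Qed.

(** In characteristic p, f_p(w + w^-1) = w^p + w^-p = (w + w^-1)^p by the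
    Frobenius map.  To obtain an identity of polynomials, take for w the
    companion matrix of the polynomial u^2 - 'X u + 1, so that w + w^-1 is the
    scalar matrix 'X. *)
Lemma cheb_f_pchar (k : comNzRingType) (p : nat) :
  p \in [pchar k] -> map_poly intr (cheb_f p) = 'X^p :> {poly k}.
Proof.
move=> chp.
pose W : 'M[{poly k}]_2 :=
  \matrix_(i, j) (if i == 0 then if j == 0 then 'X else -1
                  else if j == 0 then 1 else 0).
pose W' : 'M[{poly k}]_2 :=
  \matrix_(i, j) (if i == 0 then if j == 0 then 0 else 1
                  else if j == 0 then -1 else 'X).
have I2 (i : 'I_2) : i = 0 \/ i = 1.
  by case: i => -[|[|//]] i; [left|right]; apply: val_inj.
have eqM (P Q : 'M[{poly k}]_2) : P 0 0 = Q 0 0 -> P 0 1 = Q 0 1 ->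
    P 1 0 = Q 1 0 -> P 1 1 = Q 1 1 -> P = Q.
  by move=> *; apply/matrixP=> i j; case: (I2 i) (I2 j) => -> [] ->.
have WW' : W * W' = 1.
  by apply: eqM; rewrite -[W * W']/(_ *m _) !mxE !big_ord_recl big_ord0 !mxE /=; ring.
have W'W : W' * W = 1.
  by apply: eqM; rewrite -[W' * W]/(_ *m _) !mxE !big_ord_recl big_ord0 !mxE /=; ring.
have WDW' : W + W' = 'X%:M by apply: eqM; rewrite !mxE /=; ring.
have chM : p \in [pchar 'M[{poly k}]_2].
  rewrite inE (pcharf_prime chp) /= -(rmorph_nat (@scalar_mx _ 2)).
  by rewrite -polyC_natr (pcharf0 chp) raddf0.
have Wcomm : GRing.comm W W' by rewrite /GRing.comm WW' W'W.
have := cheb_f_inv_sum (phi := @scalar_mx {poly k} 2) p WW' W'W (esym WDW').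
have -> : W ^+ p + W' ^+ p = (W + W') ^+ p.
  by have := pFrobenius_autD_comm chM Wcomm; rewrite !pFrobenius_autE.
rewrite WDW' -rmorphXn /= => /matrixP/(_ 0 0); rewrite !mxE !mulr1n => <-.
rewrite -[LHS]comp_polyXr /comp_poly -map_poly_comp; congr (_.['X]).
by apply: eq_map_poly => c /=; rewrite rmorph_int.
Qed.

(** The coefficients of f_p - 'X^p vanish in the field with p elements, by
    [cheb_f_pchar], so p divides them. *)
Lemma cheb_f_prime (p : nat) : prime p ->
  exists d : {poly int}, (size d <= p)%N /\ cheb_f p = 'X^p + p%:Z *: d.
Proof.
move=> p_pr; pose F := cheb_f p - 'X^p.
have chp : p \in [pchar 'F_p] by exact: pchar_Fp.
have dvdF i : (p %| F`_i)%Z.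
  rewrite (dvdz_pcharf chp) -coef_map rmorphB /= cheb_f_pchar //.
  by rewrite map_polyXn subrr coef0.
exists (\poly_(i < p) (F`_i %/ p)%Z); split; first exact: size_poly.
rewrite -[LHS](subrK 'X^p) addrC; congr (_ + _); apply/polyP=> i.
rewrite coefZ coef_poly -/F; case: ltnP => [_|pi].
  by rewrite mulrC divzK.
rewrite mulr0 nth_default // (leq_trans _ pi) //.
by rewrite /F -(prednK (prime_gt0 p_pr)) size_cheb_f.
Qed.

Lemma horner_cheb_f_prime p : prime p ->
  exists d : nat -> int, forall (S : nzRingType) (x : S),
    (map_poly intr (cheb_f p)).[x] =
      x ^+ p + p%:R * \sum_(i < p) (d i)%:~R * x ^+ i.
Proof.
case/cheb_f_prime=> d [sz_d ->]; exists (fun i => d`_i) => S x.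
rewrite rmorphD /= map_polyXn hornerD hornerXn; congr (_ + _).
rewrite mulr_sumr (@horner_coef_wide _ p).
  by apply: eq_bigr => i _; rewrite coef_map coefZ /= rmorphM /= mulrA.
rewrite (leq_trans _ sz_d) // (leq_trans (size_poly _ _)) //.
exact: size_scale_leq.
Qed.

Lemma rmorph_cheb_f_pchar (S : nzRingType) (T : pzRingType)
    (phi : {rmorphism S -> T}) p (x : S) :
  prime p -> p%:R = 0 :> T ->
  phi (map_poly intr (cheb_f p)).[x] = phi x ^+ p.
Proof.
move=> p_pr pT; have [d ->] := horner_cheb_f_prime p_pr.
by rewrite rmorphD rmorphXn rmorphM rmorph_nat pT mul0r addr0.
Qed.

(** * Algebras generated by two anticommuting elements *)

(** The induction principle [gen] says that x and y generate A.  The relations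
    f_p(x) = f_p(y) = 0 enter solved for their leading terms: the p-th powers of
    x and y are p times a combination of lower powers. *)
Section Anticommuting.
Variables (R : comNzRingType) (A : pzAlgType R) (p : nat) (x y : A).
Hypothesis gen : forall P : A -> Prop,
  (forall a, P (algmap a)) -> P x -> P y ->
  (forall u v, P u -> P v -> P (u + v)) ->
  (forall u v, P u -> P v -> P (u * v)) -> forall u, P u.
Hypothesis yx : y * x = - x * y.
Variable c : nat -> R.
Hypothesis xp : x ^+ p = algmap p%:R * (\sum_(i < p) algmap (c i) * x ^+ i).
Hypothesis yp : y ^+ p = algmap p%:R * (\sum_(i < p) algmap (c i) * y ^+ i).
Hypothesis p_gt0 : (0 < p)%N.

Lemma anticomm_exp n : y * x ^+ n = (-1) ^+ n * (x ^+ n * y).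
Proof.
elim: n => [|n IHn]; first by rewrite !expr0 !mul1r mulr1.
rewrite [x ^+ _]exprS mulrA yx -[LHS]mulrA mulNr IHn [(-1) ^+ n.+1]exprS.
by rewrite mulN1r mulNr !mulrA (commr_sign x n).
Qed.

(** High powers of x and y are lowered by means of their p-th powers, so every submodule that contains
    the low monomials contains all x^i y^j.  The span of the latter is stable
    under left multiplication by x and, since y passes x^i at the cost of a
    sign, by y; hence by A, and it contains 1. *)
Lemma anticomm_span (P : A -> Prop) :
    (forall u v, P u -> P v -> P (u + v)) ->
    (forall a u, P u -> P (algmap a * u)) ->
    (forall i j, (i < p)%N -> (j < p)%N -> P (x ^+ i * y ^+ j)) ->
  forall u, P u.
Proof.
pose submodule (Q : A -> Prop) := (forall u v, Q u -> Q v -> Q (u + v)) /\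
  (forall a u, Q u -> Q (algmap a * u)).
pose low (Q : A -> Prop) :=
  forall i j, (i < p)%N -> (j < p)%N -> Q (x ^+ i * y ^+ j).
have mon Q i j : submodule Q -> low Q -> Q (x ^+ i * y ^+ j).
  move=> [QD QZ] Qlow.
  have Q0 : Q 0.
    rewrite -[0](mul0r (x ^+ 0 * y ^+ 0)) -(rmorph0 algmap).
    by apply/QZ/Qlow.
  have {Qlow} Qlow i' j' : (j' < p)%N -> Q (x ^+ i' * y ^+ j').
    move=> jp; elim/ltn_ind: i' => i' IHi; have [ip|pi] := ltnP i' p; first exact: Qlow.
    rewrite -(subnKC pi) exprD xp -!mulrA; apply: (QZ).
    rewrite mulr_suml; apply: (big_ind Q) => // l _; rewrite -!mulrA.
    by apply: (QZ); rewrite mulrA -exprD; apply: IHi; have := ltn_ord l; lia.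
  elim/ltn_ind: j i => j IHj i; have [jp|pj] := ltnP j p; first exact: Qlow.
  rewrite -(subnKC pj) exprD yp mulrA mulrA -algmapC -!mulrA.
  apply: (QZ); rewrite mulr_suml mulr_sumr; apply: (big_ind Q) => // l _.
  rewrite mulrA mulrA -algmapC -!mulrA -exprD; apply: (QZ); apply: IHj.
  by have := ltn_ord l; lia.
(* the span of the low monomials, as an intersection of submodules *)
pose W z := forall Q, submodule Q -> low Q -> Q z.
have Wx z : W z -> W (x * z).
  move=> Wz Q Qsub Qlow; apply: (Wz (fun z => Q (x * z))).
    case: (Qsub) => QD QZ; split=> [u v|a u]; first by rewrite mulrDr; apply: QD.
    by rewrite mulrA -algmapC -mulrA; apply: QZ.
  by move=> i j _ _; rewrite mulrA -exprS; apply: mon.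
have Wy z : W z -> W (y * z).
  move=> Wz Q Qsub Qlow; apply: (Wz (fun z => Q (y * z))).
    case: (Qsub) => QD QZ; split=> [u v|a u]; first by rewrite mulrDr; apply: QD.
    by rewrite mulrA -algmapC -mulrA; apply: QZ.
  move=> i j _ _; rewrite mulrA anticomm_exp -!mulrA -exprS.
  by rewrite -(rmorph_sign algmap); case: (Qsub) => _; apply; apply: mon.
have WM u : forall z, W z -> W (u * z).
  elim/gen: u => // [a z Wz Q Qsub Qlow|u v IHu IHv z Wz Q Qsub Qlow|u v IHu IHv z Wz].
  - by case: (Qsub) => _; apply; exact: (Wz Q).
  - by rewrite mulrDl; case: (Qsub) => + _; apply; [exact: (IHu z Wz Q)|exact: (IHv z Wz Q)].
  - by rewrite -mulrA; exact: IHu (IHv _ Wz).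
move=> PD PZ Plow u; rewrite -[u]mulr1; apply: WM => // Q Qsub Qlow.
by rewrite -[1]mulr1; apply: (Qlow 0 0).
Qed.

Lemma anticomm_coord u : exists e : 'I_p -> 'I_p -> R,
  u = \sum_i \sum_j algmap (e i j) * (x ^+ i * y ^+ j).
Proof.
elim/anticomm_span: u => [u v [e ->] [d ->]|a u [e ->]|i j ip jp].
- exists (fun i j => e i j + d i j); rewrite -big_split /=.
  apply: eq_bigr => i _; rewrite -big_split /=; apply: eq_bigr => j _.
  by rewrite rmorphD mulrDl.
- exists (fun i j => a * e i j); rewrite mulr_sumr; apply: eq_bigr => i _.
  by rewrite mulr_sumr; apply: eq_bigr => j _; rewrite rmorphM -!mulrA.
exists (fun k l => ((k == i :> nat) && (l == j :> nat))%:R).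
rewrite (bigD1 (Ordinal ip)) //= (bigD1 (Ordinal jp)) //= !eqxx rmorph1 mul1r.
rewrite !big1 ?addr0 // => [k /negPf ki|l /negPf lj].
  by rewrite big1 // => l _; rewrite -[k == i :> nat]/(k == Ordinal ip) ki rmorph0 mul0r.
by rewrite -[l == j :> nat]/(l == Ordinal jp) lj rmorph0 mul0r.
Qed.

End Anticommuting.

(** * Jacobson radicals over a local ring *)

Definition left_quasiregular (A : pzRingType) (x : A) : Prop :=
  forall a, exists b, b * (1 - a * x) = 1.

Section Quasiregular.
Variable A : pzRingType.

(** If x is outside a maximal left ideal I, then 1 = u + a x with u in I; but
    u = 1 - a x has a left inverse, so 1 would be in I. *)
Lemma left_quasiregular_jacobson (x : A) : left_quasiregular x -> jacobson x.
Proof.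
move=> qx I [[I0 ID IM] I1 Imax].
pose J z := exists u a, I u /\ z = u + a * x.
apply: (Imax J); last by exists 0, 1; rewrite add0r mul1r.
- split=> [|_ _ [u [a [Iu ->]]] [v [b [Iv ->]]]|b _ [u [a [Iu ->]]]].
  + by exists 0, 0; rewrite mul0r addr0.
  + by exists (u + v), (a + b); split; [exact: ID | rewrite mulrDl addrACA].
  + by exists (b * u), (b * a); split; [exact: IM | rewrite mulrDr mulrA].
- by move=> z Iz; exists z, 0; rewrite mul0r addr0.
move=> [u [a [Iu uE]]]; have [b bE] := qx a; apply: I1.
by rewrite -bE uE addrK; apply: IM.
Qed.

(** When x is normal, (a x)^n is a multiple of x^n, so 1 - (a x)^n has a left
    inverse; and 1 - a x divides 1 - (a x)^n on the right. *)
Lemma normal_left_quasiregular (x : A) n :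
    (forall a, exists a', x * a = a' * x) ->
  left_quasiregular (x ^+ n) -> left_quasiregular x.
Proof.
move=> x_normal qxn a.
have xX_normal m b : exists b', x ^+ m * b = b' * x ^+ m.
  elim: m b => [|m IHm] b; first by exists b; rewrite mul1r mulr1.
  have [b' b'E] := IHm b; have [b'' b''E] := x_normal b'.
  by exists b''; rewrite exprS -mulrA b'E mulrA b''E -mulrA.
have [c cE] : exists c, (a * x) ^+ n = c * x ^+ n.
  elim: n {qxn} => [|n [c IHn]]; first by exists 1; rewrite mul1r.
  have [a' a'E] := xX_normal n a; exists (c * a').
  by rewrite exprSr IHn mulrA -[c * _ * a]mulrA a'E -!mulrA -exprSr.
have [s sE] : exists s, 1 - (a * x) ^+ n = s * (1 - a * x).
  elim: n {qxn c cE} => [|n [s IHn]]; first by exists 0; rewrite subrr mul0r.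
  exists (s * (a * x) + 1); rewrite mulrDl mul1r -mulrA.
  have -> : a * x * (1 - a * x) = (1 - a * x) * (a * x).
    by rewrite mulrBr mulrBl mulr1 mul1r.
  by rewrite mulrA -IHn mulrBl mul1r -exprSr [RHS]addrC addrA subrK.
have [b bE] := qxn c; exists (b * s).
by rewrite -mulrA -sE cE.
Qed.

Lemma jacobson_left_ideal : left_ideal (@jacobson A).
Proof.
split=> [I [[] //]|x y Jx Jy I Imax|a x Jx I Imax]; case: (Imax) => -[I0 ID IM] _ _.
- by apply: ID; [apply: Jx | apply: Jy].
- by apply: IM; apply: Jx.
Qed.

End Quasiregular.

Section LocalBase.
Variables (O : idomainType) (k : fieldType) (res : {rmorphism O -> k}).
Hypothesis res_onto : forall z : k, exists a, res a = z.
Hypothesis res_ker : forall a, res a = 0 <-> a \isn't a GRing.unit.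

Lemma res_neq0_unit a : res a != 0 -> a \is a GRing.unit.
Proof. by apply: contraNT => /res_ker ->. Qed.

(** Nakayama's lemma by determinants.  If W is a matrix of right multiplication
    by w on the generators m_i, then right multiplication by 1 - w a has the
    matrix D = 1 - a W, which is the identity in the residue field, so that
    det D is a unit.  The adjugate of D then writes det D m_i, hence 1,
    as a left multiple of 1 - w a. *)
Lemma nonunit_left_quasiregular (A : pzAlgType O) n (m : 'I_n -> A) a :
    (forall z, exists e : 'I_n -> O, z = \sum_j algmap (e j) * m j) ->
  res a = 0 -> left_quasiregular (algmap a : A).
Proof.
move=> m_span res_a w.
have [W WE] : exists W : 'M[O]_n, forall i, m i * w = \sum_j algmap (W i j) * m j.
  have /fin_all_exists[W WE] := fun i => m_span (m i * w).
  exists (\matrix_(i, j) W i j) => i; rewrite WE.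
  by apply: eq_bigr => j _; rewrite mxE.
(* right multiplication by 1 - w a, on the generators *)
pose D := 1%:M - a *: W.
have DE i : m i * (1 - w * algmap a) = \sum_j algmap (D i j) * m j.
  rewrite mulrBr mulr1 mulrA WE -algmapC mulr_sumr.
  have -> : m i = \sum_j algmap ((1%:M : 'M[O]_n) i j) * m j.
    rewrite (bigD1 i) //= big1 => [|j /negPf ji].
      by rewrite mxE eqxx rmorph1 mul1r addr0.
    by rewrite mxE eq_sym ji rmorph0 mul0r.
  rewrite -sumrB; apply: eq_bigr => j _.
  by rewrite mulrA -rmorphM -mulrBl -rmorphB !mxE.
have unitD : \det D \is a GRing.unit.
  apply: res_neq0_unit; rewrite -det_map_mx /D map_mxB map_mxZ res_a scale0r.
  by rewrite subr0 map_scalar_mx rmorph1 det1 oner_neq0.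
have adjE i : algmap (\det D) * m i =
    (\sum_j algmap ((\adj D) i j) * m j) * (1 - w * algmap a).
  rewrite mulr_suml; under eq_bigr => j _ do rewrite -mulrA DE mulr_sumr.
  rewrite exchange_big /=.
  have -> : algmap (\det D) * m i = \sum_l algmap ((\det D)%:M i l) * m l.
    rewrite (bigD1 i) //= big1 => [|j /negPf ji].
      by rewrite mxE eqxx addr0.
    by rewrite mxE eq_sym ji rmorph0 mul0r.
  apply: eq_bigr => l _; rewrite -mul_adj_mx mxE rmorph_sum mulr_suml.
  by apply: eq_bigr => j _; rewrite mulrA -rmorphM.
have [e eE] := m_span 1.
exists (algmap (\det D)^-1 *
  \sum_i algmap (e i) * \sum_j algmap ((\adj D) i j) * m j).
rewrite -mulrA mulr_suml; under eq_bigr => i _.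
  rewrite -mulrA -adjE mulrA [X in X * _](algmapC (e i)) -mulrA; over.
by rewrite -mulr_sumr -eE mulr1 -rmorphM mulVr // rmorph1.
Qed.

Section Residue.
Variables (A : pzAlgType O) (eps : {rmorphism A -> restrict res}).
Hypothesis eps_alg : alg_morphism eps.

(** The kernel of eps is a maximal left ideal, since its quotient is the
    field k. *)
Lemma jacobson_eps0 z : jacobson z -> eps z = 0.
Proof.
move=> Jz; apply: (Jz (fun u => eps u = 0)); split=> [||J [J0 JD JM] kerJ J1 u Ju].
- split=> [|u v|a u]; first exact: rmorph0.
    by rewrite rmorphD => -> ->; rewrite addr0.
  by rewrite rmorphM => ->; rewrite mulr0.
- by rewrite rmorph1 => /eqP; rewrite oner_eq0.
have [|eps_u] := eqVneq (eps u) 0 => //; case: J1.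
have [a aE] := res_onto (eps u : k).
have Ua : a \is a GRing.unit by apply: res_neq0_unit; rewrite aE.
rewrite -(subrK (algmap a^-1 * u) 1); apply: JD; last exact: JM.
apply: kerJ; rewrite rmorphB rmorphM rmorph1 eps_alg.
by apply/eqP; rewrite subr_eq0 -aE -(rmorphM res) mulVr // rmorph1.
Qed.

Hypothesis eps_ker : forall z, eps z = 0 -> jacobson z.

Lemma local_residue_iso :
  alg_iso_prod (quot_alg (@jacobson A)) (fun _ : 'I_1 => restrict res).
Proof.
have fJ z : jacobson z -> eps z = 0 by exact: jacobson_eps0.
exists (fun _ => quot_lift fJ); split=> [_ a|d].
  by rewrite [LHS]quot_liftE eps_alg.
have [a aE] := res_onto (d ord0 : k).
exists (quot_pi _ (algmap a)); split=> [i|].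
  by rewrite quot_liftE eps_alg [i]ord1 -aE.
elim/quot_piW=> z /(_ ord0); rewrite quot_liftE => zE.
apply/quot_piP; apply: ideal_gen_sub; apply: eps_ker.
by rewrite rmorphB zE eps_alg -aE subrr.
Qed.

End Residue.

Lemma restrict_division_algebra : division_algebra (restrict res : pzAlgType O).
Proof.
split=> [|z z0]; first exact: oner_neq0.
by exists ((z : k)^-1); split; [apply: mulfV | apply: mulVf].
Qed.

End LocalBase.

Section LocalAnticommuting.
Variables (O : idomainType) (k : fieldType) (res : {rmorphism O -> k}) (p : nat).
Hypotheses (p_gt0 : (0 < p)%N) (chp : p \in [pchar k]).
Hypothesis k_residue : residue_map res.
Variables (A : pzAlgType O) (x y : A).
Hypothesis gen : forall P : A -> Prop,
  (forall a, P (algmap a)) -> P x -> P y ->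
  (forall u v, P u -> P v -> P (u + v)) ->
  (forall u v, P u -> P v -> P (u * v)) -> forall u, P u.
Hypothesis yx : y * x = - x * y.
Variable c : nat -> O.
Hypothesis xp : x ^+ p = algmap p%:R * (\sum_(i < p) algmap (c i) * x ^+ i).
Hypothesis yp : y ^+ p = algmap p%:R * (\sum_(i < p) algmap (c i) * y ^+ i).
Variable eps : {rmorphism A -> restrict res}.
Hypothesis eps_alg : alg_morphism eps.

Let algmap_quasiregular a : res a = 0 -> left_quasiregular (algmap a : A).
Proof.
have [_ res_ker] := k_residue; pose J := ('I_p * 'I_p)%type.
apply: (@nonunit_left_quasiregular _ _ _ res_ker _ #|{: J}|
  (fun j => let ij := enum_val j in x ^+ ij.1 * y ^+ ij.2)) => z.
have [e ->] := anticomm_coord gen yx xp yp p_gt0 z.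
exists (fun j => let ij := enum_val j in e ij.1 ij.2).
rewrite pair_big /=; exact: (reindex _ (onW_bij _ (enum_val_bij J))).
Qed.

Let pow_quasiregular (u s : A) : u ^+ p = algmap p%:R * s ->
  left_quasiregular (u ^+ p).
Proof.
move=> -> a; have resp : res p%:R = 0 by rewrite rmorph_nat (pcharf0 chp).
have [b bE] := algmap_quasiregular resp (a * s); exists b.
by rewrite algmapC mulrA.
Qed.

Let normal_jacobson (v s : A) :
    (exists x', v * x = x' * v) -> (exists y', v * y = y' * v) ->
  v ^+ p = algmap p%:R * s -> jacobson v.
Proof.
move=> vx vy vp; apply: left_quasiregular_jacobson.
apply: normal_left_quasiregular (pow_quasiregular vp) => w.
elim/gen: w => // [a|w1 w2 [w1' w1E] [w2' w2E]|w1 w2 [w1' w1E] [w2' w2E]].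
- by exists (algmap a); rewrite algmapC.
- by exists (w1' + w2'); rewrite mulrDr w1E w2E mulrDl.
- by exists (w1' * w2'); rewrite mulrA w1E -mulrA w2E mulrA.
Qed.

Let x_jacobson : jacobson x.
Proof.
apply: normal_jacobson xp; first by exists x.
by exists (- y); rewrite mulNr yx mulNr opprK.
Qed.

Let y_jacobson : jacobson y.
Proof. by apply: normal_jacobson yp; [exists (- x); rewrite yx | exists y]. Qed.

(** Modulo the left ideal J(A), every element is a scalar, because the
    monomials other than 1 are left multiples of x or of y, which are in J(A).
    That scalar has the same image under eps, so it is a nonunit, and
    nonunits are in J(A). *)
Lemma anticomm_eps_ker z : eps z = 0 -> jacobson z.
Proof.
have [J0 JD JM] := jacobson_left_ideal A.
have [a [u [Ju ->]]] : exists a u, jacobson u /\ z = algmap a + u.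
  elim/(anticomm_span gen yx xp yp p_gt0): z
    => [_ _ [a [u [Ju ->]]] [b [v [Jv ->]]]|b _ [a [u [Ju ->]]]|i [|j] ip jp].
  - by exists (a + b), (u + v); rewrite rmorphD addrACA; split=> //; apply: JD.
  - by exists (b * a), (algmap b * u); rewrite rmorphM mulrDr; split=> //; apply: JM.
  - rewrite mulr1; case: i {ip} => [|i].
      by exists 1, 0; rewrite rmorph1 addr0.
    by exists 0, (x ^+ i.+1); rewrite rmorph0 add0r exprSr; split=> //; apply: JM.
  exists 0, (x ^+ i * y ^+ j.+1); rewrite rmorph0 add0r; split=> //.
  by rewrite exprSr mulrA; apply: JM.
have [res_onto res_ker] := k_residue.
rewrite rmorphD (jacobson_eps0 res_onto res_ker eps_alg Ju) addr0 eps_alg => a0.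
by apply: JD => //; apply: left_quasiregular_jacobson; apply: algmap_quasiregular.
Qed.

End LocalAnticommuting.

(** * The presented algebras over O and over k *)

Section HatA.
Variables (R : comNzRingType) (p : nat).

Local Notation rels := (@hatA_rel R p).
Local Notation gam := (pres_var rels ord0).
Local Notation del := (pres_var rels ord_max).

Lemma del_gam : del * gam = - gam * del.
Proof.
by apply: quot_pi_anticomm; rewrite addrC; apply: HatA_anticomm.
Qed.

(** The relation f_p = 0 solved for its leading term, by
    [horner_cheb_f_prime]. *)
Lemma hatA_pow : prime p -> exists c : nat -> R,
  gam ^+ p = algmap p%:R * (\sum_(i < p) algmap (c i) * gam ^+ i) /\
  del ^+ p = algmap p%:R * (\sum_(i < p) algmap (c i) * del ^+ i).
Proof.
case/horner_cheb_f_prime=> d dE; exists (fun i => - (d i)%:~R).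
have key (x : free_alg R 'I_2) : rels (map_poly intr (cheb_f p)).[x] ->
    quot_pi rels x ^+ p = algmap p%:R *
      (\sum_(j < p) algmap (- (d j)%:~R) * quot_pi rels x ^+ j).
  move/quot_pi_rel; rewrite dE rmorphD rmorphXn rmorphM rmorph_sum rmorph_nat.
  move/eqP; rewrite addr_eq0 => /eqP ->; rewrite rmorph_nat -mulrN -sumrN.
  congr (_ * _); apply: eq_bigr => j _.
  by rewrite rmorphM rmorphXn rmorphN !rmorph_int mulNr.
by split; apply: key; [exact: HatA_chebX | exact: HatA_chebY].
Qed.

Section Lift.
Variables (T : pzRingType) (rho : {rmorphism R -> T}) (u v : T).
Hypothesis rho_central : forall a z, rho a * z = z * rho a.
Hypothesis uv : u * v + v * u = 0.
Hypothesis cheb_uv : forall (phi : {rmorphism free_alg R 'I_2 -> T}) X,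
  phi X = u \/ phi X = v -> phi (map_poly intr (cheb_f p)).[X] = 0.

(** The condition on u and v says f_p(u) = f_p(v) = 0, stated without a
    polynomial evaluation in T: that would exclude the zero ring, and T is to
    be instantiated by a block. *)
Lemma hatA_lift : exists f : {rmorphism hatA R p -> T},
  [/\ forall a, f (algmap a) = rho a, f gam = u & f del = v].
Proof.
pose phi := free_lift (fun i : 'I_2 => if i == ord0 then u else v) rho_central.
have phiX : phi (free_var R ord0) = u by rewrite free_lift_var.
have phiY : phi (free_var R ord_max) = v by rewrite free_lift_var.
have phi_alg a : phi (algmap a) = rho a by exact: free_lift_const.
clearbody phi.
have phi0 r : rels r -> phi r = 0.
  case; first by rewrite (rmorph_anticomm phiX phiY).
    by apply: cheb_uv; left.
  by apply: cheb_uv; right.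
exists (quot_lift phi0); split=> [a||].
- by rewrite [LHS]quot_liftE.
- by rewrite [LHS]quot_liftE.
- by rewrite [LHS]quot_liftE.
Qed.

End Lift.

End HatA.

Section AlgA.
Variables (R : comNzRingType) (p : nat).

Local Notation rels := (@algA_rel R p).

Lemma algA_lift (T : pzAlgType R) (u v : T) :
    u ^+ p = 0 -> v ^+ p = 0 -> u * v + v * u = 0 ->
  exists f : {rmorphism algA R p -> T},
    [/\ alg_morphism f, f (pres_var rels ord0) = u & f (pres_var rels ord_max) = v].
Proof.
move=> up vp uv.
pose phi := free_lift (fun i : 'I_2 => if i == ord0 then u else v)
  (@algmapC R T).
have phiX : phi (free_var R ord0) = u by rewrite free_lift_var.
have phiY : phi (free_var R ord_max) = v by rewrite free_lift_var.
have phi_alg a : phi (algmap a) = algmap a by exact: free_lift_const.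
clearbody phi.
have phi0 r : rels r -> phi r = 0.
  case; first by rewrite (rmorph_pow _ phiX).
    by rewrite (rmorph_pow _ phiY).
  by rewrite (rmorph_anticomm phiX phiY).
by exists (quot_lift phi0); split=> [a||]; rewrite [LHS]quot_liftE.
Qed.

End AlgA.

Section LocalHatA.
Variables (O : idomainType) (k : fieldType) (res : {rmorphism O -> k}) (p : nat).
Hypotheses (p_prime : prime p) (chp : p \in [pchar k]).
Hypothesis k_residue : residue_map res.

Local Notation rels := (@hatA_rel O p).
Local Notation gam := (pres_var rels ord0).
Local Notation del := (pres_var rels ord_max).

Lemma hatA_jacobson_iso :
  alg_iso_prod (quot_alg (@jacobson (hatA O p))) (fun _ : 'I_1 => restrict res).
Proof.
have [res_onto res_ker] := k_residue.
have pk : p%:R = 0 :> restrict res by exact: pcharf0 chp.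
have p_gt0 := prime_gt0 p_prime.
have [||phi X|eps [eps_alg _ _]] :=
    @hatA_lift O p (restrict res) (restrict_algmap res) 0 0.
- exact: restrict_algmapC.
- by rewrite mulr0 addr0.
- move=> phiX; rewrite rmorph_cheb_f_pchar //.
  by case: phiX => ->; rewrite expr0n eqn0Ngt p_gt0.
apply: (@local_residue_iso _ _ _ res_onto res_ker (hatA O p) eps) => //.
have [c [gamp delp]] := hatA_pow O p_prime.
exact: (anticomm_eps_ker p_gt0 chp k_residue (@pres_ind2 _ rels) (del_gam O p)
  gamp delp eps_alg).
Qed.

End LocalHatA.

Section Reduction.
Variables (O : idomainType) (k : fieldType) (res : {rmorphism O -> k}) (p : nat).
Hypotheses (p_prime : prime p) (chp : p \in [pchar k]).

Local Notation hrels := (@hatA_rel O p).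
Local Notation arels := (@algA_rel k p).
Local Notation T := (quot_alg (@tensor_rel O k res (hatA O p))).
Local Notation inT := (@tensor_in O k res (hatA O p)).

(** Over k the relations f_p = 0 become p-th powers, so each of the two
    algebras maps to the other by sending generators to generators.  The two
    composites fix the generators. *)
Lemma tensor_hatA_iso : alg_iso (tensor_alg res (hatA O p)) (algA k p).
Proof.
pose x := pres_var arels ord0; pose y := pres_var arels ord_max.
have xp : x ^+ p = 0 by apply: quot_pi_pow; apply: AlgA_powX.
have yp : y ^+ p = 0 by apply: quot_pi_pow; apply: AlgA_powY.
have xy : x * y + y * x = 0.
  apply/eqP; rewrite addr_eq0 -mulNr; apply/eqP.
  by apply: quot_pi_anticomm; apply: AlgA_anticomm.
have p_gt0 := prime_gt0 p_prime.
have [||phi X|th [th_alg th_x th_y]] :=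
    @hatA_lift O p (algA k p) (algmap \o res) x y.
- by move=> a z; apply: algmapC.
- exact: xy.
- have pA : p%:R = 0 :> algA k p.
    by rewrite -(rmorph_nat algmap) (pcharf0 chp) rmorph0.
  move=> phiX; rewrite (rmorph_cheb_f_pchar phi X p_prime pA).
  by case: phiX => ->; [exact: xp | exact: yp].
have [F [F_alg F_in]] := tensor_lift (phi := res) th_alg.
have [c [gamp delp]] := hatA_pow O p_prime.
have inT_pow (u s : hatA O p) : u ^+ p = algmap p%:R * s -> inT u ^+ p = 0.
  move=> uE; rewrite -rmorphXn uE rmorphM [X in X * _]tensor_in_alg rmorph_nat.
  by rewrite (pcharf0 chp) rmorph0 mul0r.
have [|||G [G_alg G_x G_y]] := @algA_lift k p T
    (inT (pres_var hrels ord0)) (inT (pres_var hrels ord_max)).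
- exact: inT_pow gamp.
- exact: inT_pow delp.
- rewrite -(rmorph_anticomm (erefl (inT _)) (erefl (inT _))).
  by rewrite [X in _ + X](del_gam O p) mulNr subrr rmorph0.
have GK : cancel F G.
  apply: (tensor_rmorph_ext (f := G \o F) (f' := idfun)) => [a|z].
    exact: etrans (congr1 G (F_alg a)) (G_alg a).
  apply: etrans (congr1 G (F_in z)) _.
  apply: (pres_rmorph_ext (f := G \o th) (f' := inT)) => [a|].
    apply: etrans (congr1 G (th_alg a)) _.
    transitivity (G (algmap (res a))); first exact: erefl.
    have inT_alg := @tensor_in_alg O k res (hatA O p) a.
    by rewrite G_alg; exact: esym inT_alg.
  apply: ord2_ind; first exact: etrans (congr1 G th_x) G_x.
  exact: etrans (congr1 G th_y) G_y.
have FK : cancel G F.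
  apply: (pres_rmorph_ext (f := F \o G) (f' := idfun)) => [a|].
    exact: etrans (congr1 F (G_alg a)) (F_alg a).
  apply: ord2_ind.
    exact: etrans (congr1 F G_x) (etrans (F_in _) th_x).
  exact: etrans (congr1 F G_y) (etrans (F_in _) th_y).
by exists F; split=> //; exists G.
Qed.

End Reduction.

(** * Morita equivalence of an algebra with its matrix algebras *)

Section MatrixMorita.
Variables (R : pzRingType) (B C : pzAlgType R) (n : nat).
Variables (Psi : {rmorphism 'M[C]_n.+1 -> B}) (Phi : B -> 'M[C]_n.+1).
Hypotheses (PsiK : cancel Psi Phi) (PhiK : cancel Phi Psi).
Hypothesis Psi_alg : forall a : R, Psi (algmap a)%:M = algmap a.

Let Psi_inj : injective Psi. Proof. exact: can_inj PsiK. Qed.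

Let Phi1 : Phi 1 = 1. Proof. by apply: Psi_inj; rewrite PhiK rmorph1. Qed.
Let PhiD x y : Phi (x + y) = Phi x + Phi y.
Proof. by apply: Psi_inj; rewrite PhiK rmorphD !PhiK. Qed.
Let PhiM x y : Phi (x * y) = Phi x * Phi y.
Proof. by apply: Psi_inj; rewrite PhiK rmorphM !PhiK. Qed.
Let Phi_alg a : Phi (algmap a) = (algmap a)%:M.
Proof. by apply: Psi_inj; rewrite PhiK Psi_alg. Qed.

Let E (i j : 'I_n.+1) : 'M[C]_n.+1 := delta_mx i j.

Let EE i j k l : E i j * E k l = if j == k then E i l else 0.
Proof.
rewrite /E -[_ * _]/(_ *m _) mul_delta_mx_cond.
by case: (j == k); rewrite ?mulr1n ?mulr0n.
Qed.

Let E_C i j (c : C) : c%:M * E i j = E i j * c%:M.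
Proof.
rewrite -[LHS]/(_ *m _) mul_scalar_mx -[RHS]/(_ *m _); apply/matrixP=> k l.
rewrite !mxE (bigD1 l) //= big1 => [|m /negPf ml]; rewrite !mxE ?ml ?mulr0 //.
by rewrite eqxx addr0; case: (_ && _); rewrite ?mulr1 ?mul1r ?mulr0 ?mul0r.
Qed.

Let mulE_col (X : 'M[C]_n.+1) j l : X * E j l = \sum_i E i l * (X i j)%:M.
Proof.
under eq_bigr => i _ do rewrite -E_C -[_ * _]/(_ *m _) mul_scalar_mx.
rewrite -[LHS]/(_ *m _); apply/matrixP=> k m; rewrite mxE summxE.
rewrite (bigD1 j) //= [RHS](bigD1 k) //= !mxE !eqxx.
by rewrite !big1 // => i /negPf ik; rewrite !mxE ?ik 1?eq_sym ?ik ?mulr0.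
Qed.

Section Corner.
Variable M : lmodType B.

Definition corner_pred : {pred M} := fun m => Psi (E ord0 ord0) *: m == m.

Lemma corner_closed : zmod_closed corner_pred.
Proof.
split=> [|x y /eqP ex /eqP ey]; apply/eqP; first by rewrite scaler0.
by rewrite scalerBr ex ey.
Qed.

HB.instance Definition _ := GRing.isZmodClosed.Build M corner_pred corner_closed.

Definition corner : Type := {m : M | m \in corner_pred}.
Definition to_corner (m : M) (hm : m \in corner_pred) : corner :=
  exist (fun m => m \in corner_pred) m hm.
HB.instance Definition _ := [isSub of corner for @sval _ _].
HB.instance Definition _ := [Choice of corner by <:].
HB.instance Definition _ := [SubChoice_isSubZmodule of corner by <:].

Lemma cornerP (m : corner) : Psi (E ord0 ord0) *: val m = val m.
Proof. exact: eqP (valP m). Qed.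

Lemma corner_memZ (c : C) (m : corner) :
  Psi c%:M *: val m \in corner_pred.
Proof. by apply/eqP; rewrite scalerA -rmorphM -E_C rmorphM -scalerA cornerP. Qed.

Definition corner_scale c m : corner := to_corner (corner_memZ c m).

Lemma corner_scaleA a b v :
  corner_scale a (corner_scale b v) = corner_scale (a * b) v.
Proof.
apply: val_inj; rewrite /= scalerA -rmorphM; congr (Psi _ *: _).
by rewrite scalar_mxM.
Qed.
Lemma corner_scale1 : left_id 1 corner_scale.
Proof. by move=> m; apply: val_inj; rewrite /= rmorph1 scale1r. Qed.
Lemma corner_scaleDr : right_distributive corner_scale +%R.
Proof. by move=> c x y; apply: val_inj; rewrite /= scalerDr. Qed.
Lemma corner_scaleDl v : {morph corner_scale^~ v : a b / a + b}.
Proof.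
by move=> a b; apply: val_inj; rewrite /= raddfD rmorphD scalerDl.
Qed.

Definition corner_lmod : lmodType C := HB.pack corner
  (GRing.Zmodule_isLmodule.Build C corner corner_scaleA corner_scale1
     corner_scaleDr corner_scaleDl).

Lemma corner_val_sum (I : Type) (r : seq I) (F : I -> corner_lmod) :
  \val (\sum_(i <- r) F i : corner) = \sum_(i <- r) \val (F i : corner).
Proof. by rewrite (big_morph (\val : corner -> M) (id1 := 0) (op1 := +%R)). Qed.

End Corner.

Arguments corner_pred : clear implicits.

Section Column.
Variable N : lmodType C.

Definition column : Type := {ffun 'I_n.+1 -> N}.
HB.instance Definition _ := GRing.Zmodule.on column.

Definition column_scale (b : B) (v : column) : column :=
  [ffun i => \sum_j Phi b i j *: v j].

Lemma column_scaleA a b v :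
  column_scale a (column_scale b v) = column_scale (a * b) v.
Proof.
apply/ffunP=> i; rewrite !ffunE PhiM.
under eq_bigr do rewrite ffunE scaler_sumr.
rewrite exchange_big; apply: eq_bigr => j _ /=.
rewrite -[_ * _]/(_ *m _) mxE scaler_suml.
by apply: eq_bigr => k _; rewrite scalerA.
Qed.
Lemma column_scale1 : left_id 1 column_scale.
Proof.
move=> v; apply/ffunP=> i; rewrite ffunE Phi1 (bigD1 i) //= big1 ?addr0.
  by rewrite mxE eqxx scale1r.
by move=> j /negPf ji; rewrite mxE eq_sym ji scale0r.
Qed.
Lemma column_scaleDr : right_distributive column_scale +%R.
Proof.
move=> c x y; apply/ffunP=> i; rewrite !ffunE -big_split /=.
by apply: eq_bigr => j _; rewrite ffunE scalerDr.
Qed.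
Lemma column_scaleDl v : {morph column_scale^~ v : a b / a + b}.
Proof.
move=> a b; apply/ffunP=> i; rewrite !ffunE -big_split /=.
by apply: eq_bigr => j _; rewrite PhiD mxE scalerDl.
Qed.

Definition column_lmod : lmodType B := HB.pack column
  (GRing.Zmodule_isLmodule.Build B column column_scaleA column_scale1
     column_scaleDr column_scaleDl).

End Column.

Section CornerMap.
Variables (M N : lmodType B) (f : {linear M -> N}).

Lemma corner_map_mem (m : corner M) : f (val m) \in corner_pred N.
Proof. by apply/eqP; rewrite -linearZ cornerP. Qed.

Definition corner_fun (m : corner_lmod M) : corner_lmod N :=
  to_corner (corner_map_mem m).

Lemma corner_fun_linear : linear corner_fun.
Proof. by move=> c x y; apply: val_inj; rewrite /= linearP. Qed.

Definition corner_map : {linear corner_lmod M -> corner_lmod N} :=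
  HB.pack corner_fun (GRing.isLinear.Build C _ _ _ corner_fun corner_fun_linear).

End CornerMap.

Section ColumnMap.
Variables (M N : lmodType C) (f : {linear M -> N}).

Definition column_fun (v : column_lmod M) : column_lmod N :=
  ([ffun i => f ((v : column M) i)] : column N).

Lemma column_fun_linear : linear column_fun.
Proof.
move=> b x y; apply/ffunP=> i; rewrite !ffunE linearD linear_sum.
by congr (_ + _); apply: eq_bigr => j _; rewrite ffunE linearZ.
Qed.

Definition column_map : {linear column_lmod M -> column_lmod N} :=
  HB.pack column_fun (GRing.isLinear.Build B _ _ _ column_fun column_fun_linear).

End ColumnMap.

Definition corner_functor : mod_functor B C.
Proof.
exists corner_lmod corner_map.
- by move=> M N f g fg m; apply: val_inj; rewrite /= fg.
- by move=> M m; apply: val_inj.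
- by move=> M N P g f m; apply: val_inj.
- by move=> M N f g h hE m; apply: val_inj; rewrite /= hE.
- by move=> M N a f h hE m; apply: val_inj; rewrite /= Psi_alg hE.
Defined.

Definition column_functor : mod_functor C B.
Proof.
exists column_lmod column_map.
- by move=> M N f g fg v; apply/ffunP=> i; rewrite !ffunE fg.
- by move=> M v; apply/ffunP=> i; rewrite !ffunE.
- by move=> M N P g f v; apply/ffunP=> i; rewrite !ffunE.
- by move=> M N f g h hE v; apply/ffunP=> i; rewrite !ffunE hE.
- move=> M N a f h hE v; apply/ffunP=> i; rewrite !ffunE hE Phi_alg.
  rewrite (bigD1 i) //= big1 ?addr0 => [|j /negPf ji].
    by rewrite ffunE mxE eqxx.
  by rewrite mxE eq_sym ji scale0r.
Defined.

Section Unit.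
Variable M : lmodType B.

Definition corner_glue_fun (v : column_lmod (corner_lmod M)) : M :=
  \sum_i Psi (E i ord0) *: val ((v : column _) i : corner M).

Lemma corner_glue_fun_linear : linear corner_glue_fun.
Proof.
move=> b x y; rewrite /corner_glue_fun scaler_sumr.
transitivity (\sum_i (Psi (E i ord0) *: val (((b *: x) : column _) i : corner M)
    + Psi (E i ord0) *: val ((y : column _) i : corner M))).
  by apply: eq_bigr => i _; rewrite ffunE [\val _]raddfD scalerDr.
rewrite big_split /=; congr (_ + _).
under eq_bigr => i _ do rewrite ffunE corner_val_sum scaler_sumr.
rewrite exchange_big /=; apply: eq_bigr => j _.
rewrite -[b in RHS]PhiK scalerA -rmorphM mulE_col rmorph_sum scaler_suml.
by apply: eq_bigr => i _; rewrite scalerA -rmorphM.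
Qed.

Definition corner_glue : {linear column_lmod (corner_lmod M) -> M} :=
  HB.pack corner_glue_fun
    (GRing.isLinear.Build B _ _ _ corner_glue_fun corner_glue_fun_linear).

Lemma corner_cut_mem (m : M) i : Psi (E ord0 i) *: m \in corner_pred M.
Proof. by apply/eqP; rewrite scalerA -rmorphM EE eqxx. Qed.

Definition corner_cut (m : M) : column_lmod (corner_lmod M) :=
  ([ffun i => to_corner (corner_cut_mem m i) : corner_lmod M] : column _).

Lemma corner_cutK : cancel corner_cut corner_glue.
Proof.
move=> m; rewrite /= /corner_glue_fun.
under eq_bigr => i _ do rewrite ffunE /= scalerA -rmorphM EE eqxx.
rewrite -scaler_suml -rmorph_sum /=.
suff -> : \sum_i E i i = 1 by rewrite rmorph1 scale1r.
apply/matrixP=> i j; rewrite summxE (bigD1 i) //= big1 ?addr0.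
  by rewrite !mxE eqxx /= eq_sym.
by move=> k /negPf ki; rewrite mxE eq_sym ki.
Qed.

Lemma corner_glueK : cancel corner_glue corner_cut.
Proof.
move=> v; apply/ffunP=> i; apply: val_inj; rewrite ffunE /= /corner_glue_fun.
rewrite scaler_sumr (bigD1 i) //= big1 ?addr0 => [|j /negPf ji].
  by rewrite scalerA -rmorphM EE eqxx cornerP.
by rewrite scalerA -rmorphM EE eq_sym ji rmorph0 scale0r.
Qed.

End Unit.

Section Counit.
Variable N : lmodType C.

Definition column_top_fun (w : corner_lmod (column_lmod N)) : N :=
  (val (w : corner _) : column N) ord0.

Lemma column_top_fun_linear : linear column_top_fun.
Proof.
move=> c x y; rewrite /column_top_fun /= ffunE; congr (_ + _).
rewrite ffunE PsiK (bigD1 ord0) //= big1 ?addr0; first by rewrite mxE eqxx.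
by move=> j /negPf j0; rewrite mxE eq_sym j0 scale0r.
Qed.

Definition column_top : {linear corner_lmod (column_lmod N) -> N} :=
  HB.pack column_top_fun
    (GRing.isLinear.Build C _ _ _ column_top_fun column_top_fun_linear).

Lemma E00_scale (v : column_lmod N) :
  Psi (E ord0 ord0) *: v =
    ([ffun i => if i == ord0 then (v : column N) ord0 else 0] : column N).
Proof.
apply/ffunP=> i; rewrite !ffunE PsiK (bigD1 ord0) //= big1 ?addr0.
  by rewrite mxE eqxx andbT; case: (i == _); rewrite ?scale1r ?scale0r.
by move=> j /negPf j0; rewrite mxE j0 andbF scale0r.
Qed.

Lemma column_embed_mem (x : N) :
  ([ffun i => if i == ord0 then x else 0] : column_lmod N)
    \in corner_pred (column_lmod N).
Proof.
by apply/eqP; rewrite E00_scale; apply/ffunP=> i; rewrite !ffunE eqxx.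
Qed.

Definition column_embed (x : N) : corner_lmod (column_lmod N) :=
  to_corner (column_embed_mem x).

Lemma column_embedK : cancel column_embed column_top.
Proof. by move=> x; rewrite /= /column_top_fun /= ffunE eqxx. Qed.

Lemma column_topK : cancel column_top column_embed.
Proof.
by move=> w; apply: val_inj; rewrite -[RHS]cornerP E00_scale.
Qed.

End Counit.

(** With B = M_n(C), the functor M |-> E_00 M is an equivalence from B-modules
    to C-modules, inverse to the functor N |-> N^n of columns: an element m of
    M is determined by its components E_0i m, and a column in E_00 N^n by its
    first entry. *)
Lemma matrix_morita_equivalent : morita_equivalent B C.
Proof.
exists corner_functor, column_functor; split.
- exists corner_glue; split=> [M|M N f v].
    by exists (@corner_cut M); [apply: corner_glueK | apply: corner_cutK].
  rewrite /= /corner_glue_fun linear_sum; apply: eq_bigr => i _.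
  by rewrite linearZ ffunE.
- exists column_top; split=> [N|M N f w].
    by exists (@column_embed N); [apply: column_topK | apply: column_embedK].
  by rewrite /= /column_top_fun /= ffunE.
Qed.

End MatrixMorita.

(** * Matrix units *)

Section MatrixUnits.
Variables (C B : pzRingType) (n : nat) (f : {rmorphism C -> B}).
Variable E : 'I_n -> 'I_n -> B.
Hypothesis EE : forall i j k l, E i j * E k l = if j == k then E i l else 0.
Hypothesis E1 : \sum_i E i i = 1.
Hypothesis fE : forall c i j, f c * E i j = E i j * f c.

Definition matrix_lift_fun (X : 'M[C]_n) : B := \sum_i \sum_j E i j * f (X i j).

Lemma matrix_lift_zmod : zmod_morphism matrix_lift_fun.
Proof.
move=> X Y; rewrite /matrix_lift_fun -sumrB; apply: eq_bigr => i _.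
by rewrite -sumrB; apply: eq_bigr => j _; rewrite !mxE rmorphB mulrBr.
Qed.

Lemma matrix_lift_monoid : monoid_morphism matrix_lift_fun.
Proof.
split=> [|X Y].
  rewrite -[RHS]E1; apply: eq_bigr => i _; rewrite (bigD1 i) //= big1 ?addr0.
    by rewrite mxE eqxx rmorph1 mulr1.
  by move=> j /negPf ji; rewrite mxE eq_sym ji rmorph0 mulr0.
rewrite /matrix_lift_fun mulr_suml; apply: eq_bigr => i _.
under eq_bigr => l _ do rewrite -[X * Y]/(X *m Y) mxE rmorph_sum mulr_sumr.
rewrite exchange_big mulr_suml; apply: eq_bigr => j _ /=.
rewrite [RHS]mulr_sumr [RHS](bigD1 j) //= [Z in _ = _ + Z]big1 ?addr0; last first.
  move=> k /negPf kj; rewrite mulr_sumr big1 // => l _.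
  by rewrite mulrA -[E i j * _ * _]mulrA fE mulrA EE eq_sym kj !mul0r.
rewrite mulr_sumr; apply: eq_bigr => l _.
by rewrite mulrA -[E i j * _ * _]mulrA fE mulrA EE eqxx rmorphM mulrA.
Qed.

Definition matrix_lift : {rmorphism 'M[C]_n -> B} :=
  HB.pack matrix_lift_fun
    (GRing.isZmodMorphism.Build _ _ matrix_lift_fun matrix_lift_zmod)
    (GRing.isMonoidMorphism.Build _ _ matrix_lift_fun matrix_lift_monoid).

Lemma matrix_liftE X : matrix_lift X = \sum_i \sum_j E i j * f (X i j).
Proof. by []. Qed.

Lemma matrix_lift_scalar c : matrix_lift c%:M = f c.
Proof.
rewrite -[RHS]mul1r -E1 mulr_suml; apply: eq_bigr => i _.
rewrite (bigD1 i) //= big1 ?addr0; first by rewrite mxE eqxx mulr1n.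
by move=> j /negPf ji; rewrite mxE eq_sym ji mulr0n rmorph0 mulr0.
Qed.

Lemma matrix_lift_delta i j : matrix_lift (delta_mx i j) = E i j.
Proof.
rewrite matrix_liftE (bigD1 i) //= (bigD1 j) //= mxE !eqxx rmorph1 mulr1.
rewrite !big1 ?addr0 // => [k /negPf ki|l /negPf lj].
  by rewrite big1 // => l _; rewrite mxE ki rmorph0 mulr0.
by rewrite mxE lj andbF rmorph0 mulr0.
Qed.

End MatrixUnits.

Section QuaternionUnits.
Variables (O : idomainType) (B : pzAlgType O) (iota : O) (S T : B).
Hypotheses (two_unit : (2 : O) \is a GRing.unit) (iota2 : iota * iota = -1).
Hypotheses (SS : S * S = -1) (TT : T * T = -1) (TS : T * S = - (S * T)).

Let J : B := algmap iota * S.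
Let c : B := algmap 2^-1.

(** The idempotent (1 + iota S) / 2: iota S squares to 1. *)
Definition quat_proj : B := c * (1 + J).
Local Notation P := quat_proj.
Let P' : B := c * (1 - J).

Lemma algmap_half2 : c * (1 + 1) = 1.
Proof. by rewrite /c -(rmorph1 algmap) -rmorphD -rmorphM mulVr // rmorph1. Qed.

Let JJ : J * J = 1.
Proof.
rewrite /J -mulrA [S * _]mulrA -algmapC -mulrA SS mulrA -rmorphM iota2.
by rewrite rmorphN1 mulrN1 opprK.
Qed.

Let TJ : T * J = - (J * T).
Proof. by rewrite /J mulrA -algmapC -mulrA TS mulrN mulrA. Qed.

Let cM u v : c * u * (c * v) = c * (c * (u * v)).
Proof. by rewrite -mulrA [u * _]mulrA -[u * c]algmapC -[c * u * v]mulrA. Qed.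

Lemma quat_proj_idem : P * P = P.
Proof.
rewrite /P cM (_ : (1 + J) * (1 + J) = (1 + 1) * (1 + J)).
  by congr (_ * _); rewrite mulrA algmap_half2 mul1r.
rewrite [LHS]mulrDr mulr1 [Z in _ + Z]mulrDl mul1r JJ [Z in _ + Z]addrC.
by rewrite [RHS]mulrDl mul1r.
Qed.

Let PT : P * T = T * P'.
Proof.
rewrite /P /P' [RHS]mulrA -algmapC -!mulrA; congr (_ * _).
by rewrite mulrDl mulrBr mul1r mulr1 TJ opprK.
Qed.

Let P'P : P' * P = 0.
Proof.
rewrite /P /P' cM mulrDr mulr1 mulrBl mul1r JJ addrC.
by rewrite -[J - 1]opprB addrC subrr !mulr0.
Qed.

Let TN : T * - T = 1. Proof. by rewrite mulrN TT opprK. Qed.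
Let NT : - T * T = 1. Proof. by rewrite mulNr TT opprK. Qed.

(** T anticommutes with iota S and so exchanges P and 1 - P; as - T is
    the inverse of T, conjugating P by powers of T yields matrix units. *)
Definition quat_unit (i j : 'I_2) : B := T ^+ i * P * (- T) ^+ j.
Local Notation E := quat_unit.

Lemma quat_unitM i j k l : E i j * E k l = if j == k then E i l else 0.
Proof.
have PTP u v : u * P * (T * P * v) = 0.
  rewrite mulrA -[u * P * (T * P)]mulrA [P * (T * P)]mulrA PT.
  by rewrite -[T * P' * P]mulrA P'P !mulr0 mul0r.
rewrite /E -[_ * (- T) ^+ j * _]mulrA [(- T) ^+ j * _]mulrA [(- T) ^+ j * _]mulrA.
elim/ord2_ind: j; elim/ord2_ind: k => /=; rewrite ?expr0 ?expr1.
- by rewrite !mul1r mulrA -[T ^+ i * P * P]mulrA quat_proj_idem.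
- by rewrite mul1r PTP.
- by rewrite mulr1 !mulNr mulrN PTP oppr0.
- by rewrite NT mul1r mulrA -[T ^+ i * P * P]mulrA quat_proj_idem.
Qed.

Lemma quat_unit_sum : \sum_i E i i = 1.
Proof.
rewrite !big_ord_recl big_ord0 addr0 /E /= !expr0 !expr1 mul1r mulr1.
have -> : T * P * - T = P'.
  have TP : T * P = P' * T.
    rewrite /P /P' mulrA -algmapC -!mulrA; congr (_ * _).
    by rewrite mulrDr mulrBl mulr1 mul1r TJ.
  by rewrite TP -mulrA TN mulr1.
by rewrite /P /P' -mulrDr addrACA subrr addr0 algmap_half2.
Qed.

Lemma quat_unit_comm (b : B) : b * S = S * b -> b * T = T * b ->
  forall i j, b * E i j = E i j * b.
Proof.
move=> bS bT i j; have bTX n : b * T ^+ n = T ^+ n * b.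
  by apply: commrX.
have bNTX n : b * (- T) ^+ n = (- T) ^+ n * b by apply: commrX; apply: commrN.
have bP : b * P = P * b.
  rewrite /P mulrA -algmapC -!mulrA; congr (_ * _).
  by rewrite mulrDl mulrDr mul1r mulr1 /J mulrA -algmapC -!mulrA bS.
by rewrite /E mulrA [b * _]mulrA bTX -(mulrA _ b) bP mulrA -(mulrA _ b) bNTX mulrA.
Qed.

(** Indeed S = - iota (2 E_00 - 1) and T = E_10 - E_01. *)
Lemma quat_units_gen (Q : B -> Prop) :
    (forall a, Q (algmap a)) ->
    (forall u v, Q u -> Q v -> Q (u + v)) ->
    (forall u v, Q u -> Q v -> Q (u * v)) ->
    (forall i j, Q (E i j)) ->
  Q S /\ Q T.
Proof.
move=> Qa QD QM QE.
have QN u : Q u -> Q (- u).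
  by move=> Qu; rewrite -mulN1r -(rmorphN1 algmap); apply: (QM).
have Q1 : Q 1 by rewrite -(rmorph1 algmap).
split.
  have -> : S = - algmap iota * ((1 + 1) * E ord0 ord0 - 1).
    rewrite /E /= !expr0 mul1r mulr1 /P mulrA -algmapC algmap_half2 mul1r.
    rewrite addrAC subrr add0r /J mulrA mulNr -rmorphM iota2.
    by rewrite rmorphN1 opprK mul1r.
  by apply: (QM); [apply: QN | apply: (QD); [apply: (QM) => //; apply: QD | apply: QN]].
have -> : T = E ord_max ord0 - E ord0 ord_max.
  rewrite /E /= !expr0 !expr1 mulr1 mul1r mulrN opprK PT -mulrDr.
  by rewrite /P /P' -mulrDr addrACA subrr addr0 algmap_half2 mulr1.
by apply: QD => //; apply: QN.
Qed.

End QuaternionUnits.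

(** * Invertible elements seen through their twisted differences *)

Section InvertibleDifference.
Variables (A : pzRingType) (p : nat) (G G' : A).
Hypotheses (p_odd : odd p) (GG' : G * G' = 1) (G'G : G' * G = 1).
Hypotheses (Gp : G ^+ p = 1) (G'p : G' ^+ p = 1).

(** Write U (G - G') = w + w' with w = U G and w' = - U G'.  These are inverse
    to each other because U^2 = -1, and w^p + w'^p = U^p - U^p = 0
    because p is odd and the p-th powers of G and G' are 1. *)
Lemma cheb_f_twisted_difference (U : A) (S : nzRingType)
    (phi : {rmorphism S -> A}) (x : S) :
    GRing.comm U G -> GRing.comm U G' -> U * U = -1 ->
    phi x = U * (G - G') ->
  phi (map_poly intr (cheb_f p)).[x] = 0.
Proof.
move=> UG UG' UU phix.
have UV V W : GRing.comm U V -> V * W = 1 -> U * V * (U * W) = -1.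
  by move=> UV VW; rewrite UV -mulrA [U * (U * W)]mulrA UU mulN1r mulrN VW.
rewrite (@cheb_f_inv_sum _ _ phi x (U * G) (- (U * G'))).
- rewrite exprNn -signr_odd p_odd expr1 mulN1r !exprMn_comm //.
  by rewrite Gp G'p subrr.
- by rewrite mulrN UV ?opprK.
- by rewrite mulNr UV ?opprK.
- by rewrite phix mulrBr.
Qed.

(** Since (G - G')^2 + 2 = G^2 + G'^2, the subring P contains all
    G^(2n) + G'^(2n), by the recursion of [cheb_f_inv_sum].  For 2n = p + 1
    this is G + G'; and 2 G = (G + G') + (G - G'). *)
Lemma invertible_mem (P : A -> Prop) (half : A) :
    half * (1 + 1) = 1 -> P half -> P 1 -> (forall u, P u -> P (- u)) ->
    (forall u v, P u -> P v -> P (u + v)) ->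
    (forall u v, P u -> P v -> P (u * v)) ->
  P (G - G') -> P G.
Proof.
move=> algmap_half2 Ph P1 PN PD PM PGG'.
pose a n := G ^+ n.*2 + G' ^+ n.*2.
have a1 : P (a 1%N).
  have -> : a 1%N = (G - G') * (G - G') + (1 + 1).
    rewrite /a /= !expr2 mulrBr !mulrBl GG' G'G opprB.
    by rewrite [Z in _ = Z + _]addrACA -opprD subrK.
  by apply: (PD); [apply: (PM) | apply: (PD)].
have aS n : a n.+2 = a 1%N * a n.+1 - a n.
  rewrite /a mulrDl !mulrDr -!exprD !add2n !doubleS.
  have GX m : G ^+ 2 * G' ^+ m.+2 = G' ^+ m.
    rewrite -[m.+2]/(2 + m)%N exprD mulrA !expr2 mulrA -[G * G * G']mulrA GG'.
    by rewrite mulr1 GG' mul1r.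
  have G'X m : G' ^+ 2 * G ^+ m.+2 = G ^+ m.
    rewrite -[m.+2]/(2 + m)%N exprD mulrA !expr2 mulrA -[G' * G' * G]mulrA G'G.
    by rewrite mulr1 G'G mul1r.
  rewrite GX G'X [Z in _ = _ + Z - _]addrC [Z in _ = Z - _]addrACA.
  by rewrite [G' ^+ n.*2 + _]addrC addrK.
have aP n : P (a n).
  suff: P (a n) /\ P (a n.+1) by case.
  elim: n => [|n [IH1 IH2]]; split=> //.
    by rewrite /a !expr0; apply: (PD).
  by rewrite aS; apply: (PD); [apply: (PM) | apply: (PN)].
have aG : P (G + G').
  have := aP p.+1./2; rewrite /a.
  have -> : (p.+1./2).*2 = p.+1 by rewrite -[RHS]odd_double_half /= p_odd.
  by rewrite !exprS Gp G'p !mulr1.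
rewrite (_ : G = half * ((G + G') + (G - G'))); last first.
  rewrite addrACA subrr addr0 -[G in RHS]mul1r -mulrDl.
  by rewrite mulrA algmap_half2 mul1r.
by apply: (PM) => //; apply: (PD).
Qed.

End InvertibleDifference.

(** * The group (C_p x C_p) : Q_8 *)

Section Group.
Variables (p : nat) (gT : finGroupType) (g h s t : gT).
Hypothesis hG : CpCp_Q8 p g h s t.
Local Open Scope group_scope.

Lemma CpCp_Q8_st : s * t = t^-1 * s.
Proof.
have s4 := CpCpQ8_s4 hG; have s2 := CpCpQ8_s2 hG; have sts := CpCpQ8_sts3 hG.
have s3 : s ^+ 3 = s^-1 by apply/eqP; rewrite eq_sym eq_invg_mul -expgS s4.
have t3 : t ^+ 3 = t^-1.
  by apply/eqP; rewrite eq_sym eq_invg_mul -expgS (expgM t 2 2) -s2 -expgM s4.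
by rewrite -t3 -sts s3 mulgKV.
Qed.

Lemma CpCp_Q8_conj : s ^ t = s^-1.
Proof.
have s4 := CpCpQ8_s4 hG; have s2 := CpCpQ8_s2 hG.
rewrite conjgE CpCp_Q8_st mulgA -invMg -[t * t]/(t ^+ 2) -s2.
by rewrite expgS expg1 invMg mulgKV.
Qed.

Lemma Q8_relations (rT : finGroupType) (x y : rT) :
  x ^+ 4 = 1 -> y ^+ 2 = x ^+ 2 -> x ^ y = x^-1 -> x * y * x ^+ 3 = y ^+ 3.
Proof.
move=> x4 y2 xy; have -> : x * y = y * x^-1 by rewrite -xy conjgE !mulgA mulgV mul1g.
by rewrite -mulgA -[x ^+ 3]/(x * (x * x)) mulKg -[x * x]/(x ^+ 2) -y2.
Qed.

(** The relations that present <s, t> are equivalent to the usual ones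
    x^4 = 1, y^2 = x^2, x^y = x^-1 of the quaternion group, so each of the two
    groups is a quotient of the other. *)
Lemma CpCp_Q8_card_Q : #|<<[set s; t]>>| = 8.
Proof.
have joinE (rT : finGroupType) (x y : rT) : <[x]> <*> <[y]> = <<[set x; y]>>.
  by rewrite joing_idl joing_idr.
have Q8E := @Grp_quaternion 3 isT; have pres := CpCpQ8_pres hG.
have homQ : <<[set s; t]>> \homg 'Q_8.
  rewrite Q8E; apply/existsP; exists (s, t); rewrite /= !xpair_eqE joinE eqxx.
  by rewrite (CpCpQ8_s4 hG) -(CpCpQ8_s2 hG) CpCp_Q8_conj !eqxx.
have homQ8 : 'Q_8 \homg <<[set s; t]>>.
  have := homg_refl 'Q_8; rewrite Q8E => /existsP[[x y]] /=; rewrite !xpair_eqE.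
  case/and4P=> /eqP xyE /eqP x4 /eqP y2 /eqP xy.
  rewrite pres; apply/existsP; exists (x, y); rewrite /= !xpair_eqE.
  by rewrite xyE x4 y2 (Q8_relations x4 y2 xy) !eqxx.
have oQ8 : #|'Q_8| = 8 by exact: (@card_quaternion 3).
apply: etrans oQ8; apply/eqP; rewrite eqn_leq.
by rewrite (leq_homg homQ) (leq_homg homQ8).
Qed.

Lemma CpCp_Q8_card : #|gT| = (p * p * 8)%N.
Proof.
have /sdprod_card := CpCpQ8_sdprod hG; rewrite cardsT CpCp_Q8_card_Q => <-.
have /sdprodP[[N Q dN _] _ _ _] := CpCpQ8_sdprod hG.
by rewrite dN -(dprod_card dN) -!orderE (CpCpQ8_order_g hG) (CpCpQ8_order_h hG).
Qed.

(** The subgroup <s> is normalized by t, so <s, t> = <s> <t>. *)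
Lemma CpCp_Q8_elt x : exists a b i j, x = g ^+ a * h ^+ b * (s ^+ i * t ^+ j).
Proof.
have /sdprodP[[N Q dN dQ] NQ _ _] := CpCpQ8_sdprod hG.
have : x \in [set: gT] by rewrite inE.
rewrite -NQ dN => /mulsgP[n q Nn Qq ->].
have /dprodP[_ eN _ _] := dN.
move: Nn; rewrite -eN => /mulsgP[_ _ /cycleP[a ->] /cycleP[b ->] ->].
have Qq' : q \in <[s]> * <[t]>.
  rewrite -norm_joinEr; first by rewrite joing_idl joing_idr.
  by rewrite cycle_subG; apply/normP; rewrite -cycleJ CpCp_Q8_conj cycleV.
by move: Qq' => /mulsgP[_ _ /cycleP[i ->] /cycleP[j ->] ->]; exists a, b, i, j.
Qed.

End Group.

(** * The nonprincipal block as a matrix algebra *)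

(** The relations that hold in the nonprincipal block between the images of
    g, h, s, t; G' and H' stand for the inverses of G and H. *)
Section TwistedGroup.
Variables (O : idomainType) (p : nat) (B : pzAlgType O) (iota : O).
Variables (G G' H H' S T : B).
Hypotheses (two_unit : (2 : O) \is a GRing.unit) (iota2 : iota * iota = -1).
Hypotheses (SS : S * S = -1) (TT : T * T = -1) (TS : T * S = - (S * T)).
Hypotheses (GG' : G * G' = 1) (G'G : G' * G = 1) (HH' : H * H' = 1) (H'H : H' * H = 1).
Hypotheses (Gp : G ^+ p = 1) (G'p : G' ^+ p = 1) (Hp : H ^+ p = 1) (H'p : H' ^+ p = 1).
Hypotheses (SG : S * G = G' * S) (SG' : S * G' = G * S).
Hypotheses (SH : S * H = H * S) (SH' : S * H' = H' * S).
Hypotheses (TG : T * G = G * T) (TG' : T * G' = G' * T).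
Hypotheses (TH : T * H = H' * T) (TH' : T * H' = H * T).
Hypothesis GHcomm : (G - G') * (H - H') = (H - H') * (G - G').
Hypothesis gen : forall Q : B -> Prop,
  (forall a, Q (algmap a)) ->
  (forall u v, Q u -> Q v -> Q (u + v)) ->
  (forall u v, Q u -> Q v -> Q (u * v)) ->
  Q G -> Q H -> Q S -> Q T -> forall b, Q b.
Hypothesis p_odd : odd p.

Let gamB := T * (G - G').
Let delB := S * (H - H').

Let gam_S : gamB * S = S * gamB.
Proof.
rewrite /gamB mulrA -[S * T]opprK -TS mulNr -!mulrA -mulrN; congr (_ * _).
by rewrite mulrBl mulrBr SG SG' opprB.
Qed.
Let gam_T : gamB * T = T * gamB.
Proof. by rewrite /gamB -!mulrA; congr (_ * _); rewrite mulrBl mulrBr TG TG'. Qed.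
Let del_S : delB * S = S * delB.
Proof. by rewrite /delB -!mulrA; congr (_ * _); rewrite mulrBl mulrBr SH SH'. Qed.
Let del_T : delB * T = T * delB.
Proof.
rewrite /delB mulrA TS mulNr -!mulrA -mulrN; congr (_ * _).
by rewrite mulrBl mulrBr TH TH' opprB.
Qed.

Let gam_del : gamB * delB + delB * gamB = 0.
Proof.
rewrite {1}/delB mulrA gam_S {2}/gamB mulrA del_T.
rewrite /gamB /delB !mulrA TS -!mulrA mulNr GHcomm -!mulrA.
by rewrite subrr.
Qed.

(** The elements gamB = T (G - G') and delB = S (H - H') commute with S and T,
    because the anticommutation of S and T compensates the inversion of G by
    S and of H by T.  Hence the image of hatA, which they generate,
    commutes with the matrix units made of S and T, and M_2(hatA) maps to B.
    The image contains S and T, hence G - G' = - T gamB and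
    H - H' = - S delB, hence G and H by [invertible_mem]. *)
Lemma hatA_matrix_epi :
  exists (Phi : {rmorphism hatA O p -> B}) (E : 'I_2 -> 'I_2 -> B)
         (Psi : {rmorphism 'M[hatA O p]_2 -> B}),
    [/\ alg_morphism Phi, forall X, Psi X = \sum_i \sum_j E i j * Phi (X i j),
        forall c, Psi c%:M = Phi c & forall b, exists X, Psi X = b].
Proof.
have chebG := cheb_f_twisted_difference p_odd GG' G'G Gp G'p TG TG' TT.
have chebH := cheb_f_twisted_difference p_odd HH' H'H Hp H'p SH SH' SS.
have [||phi X [/chebG|/chebH]|Phi [Phi_alg Phi_gam Phi_del]] :=
  @hatA_lift O p B algmap gamB delB => //.
  exact: algmapC.
pose E := quat_unit iota S T.
have PhiC b c : gamB * b = b * gamB -> delB * b = b * delB ->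
    Phi c * b = b * Phi c.
  move=> gam_b del_b; elim/pres_ind2: c => [a|||u v|u v] /=.
  - by rewrite Phi_alg algmapC.
  - by rewrite Phi_gam.
  - by rewrite Phi_del.
  - by rewrite rmorphD mulrDl mulrDr => -> ->.
  - by rewrite rmorphM -mulrA => uS ->; rewrite mulrA uS mulrA.
have EE := quat_unitM two_unit iota2 SS TT TS.
have E1 : \sum_i E i i = 1 by exact: quat_unit_sum.
have PhiE c : forall i j, Phi c * E i j = E i j * Phi c.
  by apply: quat_unit_comm; apply: PhiC.
pose Psi := matrix_lift EE E1 PhiE.
have PsiC c : Psi c%:M = Phi c by exact: matrix_lift_scalar.
have PsiE i j : Psi (delta_mx i j) = E i j by exact: matrix_lift_delta.
exists Phi, E, Psi; split=> //.
clearbody Psi.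
pose Q b := exists X, Psi X = b.
have Qalg a : Q (algmap a) by exists (algmap a)%:M; rewrite PsiC Phi_alg.
have QD u v : Q u -> Q v -> Q (u + v).
  by move=> [X <-] [Y <-]; exists (X + Y); rewrite rmorphD.
have QM u v : Q u -> Q v -> Q (u * v).
  by move=> [X <-] [Y <-]; exists (X * Y); rewrite rmorphM.
have QN u : Q u -> Q (- u) by move=> [X <-]; exists (- X); rewrite rmorphN.
have Q1 : Q 1 by exists 1; rewrite rmorph1.
have QPhi c : Q (Phi c) by exists c%:M.
have QE i j : Q (E i j) by exists (delta_mx i j).
have [QS QT] : Q S /\ Q T by exact: (quat_units_gen (iota := iota)).
have QG : Q G.
  apply: (invertible_mem p_odd GG' G'G Gp G'p (algmap_half2 B two_unit)) => //.
  have -> : G - G' = - (T * Phi (pres_var (@hatA_rel O p) ord0)).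
    by rewrite Phi_gam /gamB mulrA TT mulN1r opprK.
  by apply: QN; apply: QM.
have QH : Q H.
  apply: (invertible_mem p_odd HH' H'H Hp H'p (algmap_half2 B two_unit)) => //.
  have -> : H - H' = - (S * Phi (pres_var (@hatA_rel O p) ord_max)).
    by rewrite Phi_del /delB mulrA SS mulN1r opprK.
  by apply: QN; apply: QM.
exact: gen.
Qed.

End TwistedGroup.

(** In coordinates, a spanning family is a right inverse of a square matrix,
    and over a commutative ring right inverses of square matrices are
    two-sided. *)
Lemma spanning_free (R : comNzRingType) (gT : finGroupType) (I : finType)
    (v : I -> group_alg R gT) (c : I -> R) :
    #|I| = #|gT| ->
    (forall x, exists d : I -> R, x = \sum_i d i *: v i) ->
    \sum_i c i *: v i = 0 ->
  forall i, c i = 0.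
Proof.
move=> cardI v_span cv0.
have mulC1 m n (P : 'M[R]_(m, n)) (Q : 'M_(n, m)) :
    m = n -> P *m Q = 1%:M -> Q *m P = 1%:M.
  by move=> mn; case: n / mn P Q => P Q /mulmx1C.
have [P PE] : exists P : gT -> I -> R,
    forall x, mon_elt x = \sum_i P x i *: v i.
  exact: fin_all_exists (fun x => v_span (mon_elt x)).
pose PM := \matrix_(x < #|gT|, i < #|I|) P (enum_val x) (enum_val i).
pose QM := \matrix_(i < #|I|, x < #|gT|) (v (enum_val i))@_(enum_val x).
have PQ : PM *m QM = 1%:M.
  apply/matrixP=> x y; rewrite !mxE.
  have := congr1 (mcoeff (enum_val y)) (PE (enum_val x)).
  rewrite mcoeffU raddf_sum /= (inj_eq enum_val_inj) => ->.
  rewrite [RHS](reindex _ (onW_bij _ (enum_val_bij I))) /=.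
  by apply: eq_bigr => i _; rewrite !mxE mcoeffZ.
have cQ : (\row_i c (enum_val i)) *m QM = 0.
  apply/rowP=> x; rewrite !mxE.
  have := congr1 (mcoeff (enum_val x)) cv0; rewrite mcoeff0 raddf_sum => cvx.
  apply: etrans cvx.
  rewrite [RHS](reindex _ (onW_bij _ (enum_val_bij I))) /=.
  by apply: eq_bigr => i _; rewrite !mxE mcoeffZ.
have QP := mulC1 _ _ PM QM (esym cardI) PQ.
have c0 : (\row_i c (enum_val i) : 'rV[R]_#|I|) = 0.
  by rewrite -[X in X = _]mulmx1 -QP mulmxA cQ mul0mx.
move=> i; have := congr1 (fun r : 'rV[R]_#|I| => r 0 (enum_rank i)) c0.
by rewrite !mxE enum_rankK.
Qed.

Section BlockProjection.
Variables (R : pzRingType) (A : pzAlgType R) (e : A) (he : central_idempotent e).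

Lemma block_proj_zmod : zmod_morphism (block_proj he).
Proof. by move=> x y; apply: val_inj; rewrite /= mulrBl. Qed.

Lemma block_proj_monoid : monoid_morphism (block_proj he).
Proof.
split=> [|x y]; apply: val_inj; rewrite /= ?mul1r //.
by rewrite mulrA -[x * e * y]mulrA he.2 mulrA -[in RHS]mulrA he.1.
Qed.

HB.instance Definition _ :=
  GRing.isZmodMorphism.Build A (block_alg he) (block_proj he) block_proj_zmod.
HB.instance Definition _ :=
  GRing.isMonoidMorphism.Build A (block_alg he) (block_proj he) block_proj_monoid.

Lemma block_valK : cancel val (block_proj he).
Proof. by move=> x; apply: val_inj; apply: eqP (valP x). Qed.

Lemma block_val_algmapM a (x : block_alg he) :
  val (algmap a * x) = algmap a * val x.
Proof. by rewrite /= -mulrA he.2 (eqP (valP x)). Qed.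

Lemma block_val_sum (I : finType) (F : I -> block_alg he) :
  val (\sum_i F i) = \sum_i val (F i).
Proof. exact: (big_morph val (id1 := 0) (op1 := +%R)). Qed.

End BlockProjection.

Section Representation.
Variables (O : idomainType) (p : nat) (gT : finGroupType) (g h s t : gT).
Hypotheses (two_unit : (2 : O) \is a GRing.unit) (hG : CpCp_Q8 p g h s t).
Hypothesis p_odd : odd p.
Variable iota : O.
Hypothesis iota2 : iota * iota = -1.
Variables (B : pzAlgType O) (u : gT -> B).
Hypotheses (u1 : u 1%g = 1) (uM : forall x y, u (x * y)%g = u x * u y).
Hypothesis u_z : u (s ^+ 2)%g = -1.
Hypothesis u_span : forall Q : B -> Prop,
  (forall a, Q (algmap a)) ->
  (forall v w, Q v -> Q w -> Q (v + w)) ->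
  (forall v w, Q v -> Q w -> Q (v * w)) ->
  (forall x, Q (u x)) -> forall b, Q b.

Let uX x n : u (x ^+ n)%g = u x ^+ n.
Proof. by elim: n => [|n IHn]; rewrite ?u1 // expgS exprS uM IHn. Qed.

Let sg : (s * g = g^-1 * s)%g. Proof. by rewrite -(CpCpQ8_sg hG) mulgKV. Qed.
Let sg' : (s * g^-1 = g * s)%g.
Proof.
by apply: (mulgI g^-1%g); rewrite !mulgA mulVg mul1g -sg mulgK.
Qed.
Let sh : (s * h = h * s)%g. Proof. by rewrite -{2}(CpCpQ8_sh hG) mulgKV. Qed.
Let sh' : (s * h^-1 = h^-1 * s)%g.
Proof. exact: commuteV. Qed.
Let tg : (t * g = g * t)%g. Proof. by rewrite -{2}(CpCpQ8_tg hG) mulgKV. Qed.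
Let tg' : (t * g^-1 = g^-1 * t)%g.
Proof. exact: commuteV. Qed.
Let th : (t * h = h^-1 * t)%g. Proof. by rewrite -(CpCpQ8_th hG) mulgKV. Qed.
Let th' : (t * h^-1 = h * t)%g.
Proof.
by apply: (mulgI h^-1%g); rewrite !mulgA mulVg mul1g -th mulgK.
Qed.
Let gp : (g ^+ p = 1)%g. Proof. by rewrite -(CpCpQ8_order_g hG) expg_order. Qed.
Let hp : (h ^+ p = 1)%g. Proof. by rewrite -(CpCpQ8_order_h hG) expg_order. Qed.

Let gh : commute g h.
Proof.
have /sdprodP[[N Q dN dQ] _ _ _] := CpCpQ8_sdprod hG.
have /dprodP[_ _ cgh _] := dN.
by apply/commute_sym/(centsP cgh); apply: cycle_id.
Qed.

Let u_ts : u t * u s = - (u s * u t).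
Proof.
rewrite -!uM -mulN1r -u_z -uM (CpCpQ8_s2 hG) (CpCp_Q8_st hG).
by rewrite mulgA mulgK.
Qed.

Let u_gen (Q : B -> Prop) :
  (forall a, Q (algmap a)) ->
  (forall v w, Q v -> Q w -> Q (v + w)) ->
  (forall v w, Q v -> Q w -> Q (v * w)) ->
  Q (u g) -> Q (u h) -> Q (u s) -> Q (u t) -> forall b, Q b.
Proof.
move=> Qa QD QM Qg Qh Qs Qt; apply: u_span => // x.
have QX v n : Q v -> Q (v ^+ n).
  move=> Qv; elim: n => [|n IHn]; first by rewrite expr0 -(rmorph1 algmap).
  by rewrite exprS; apply: (QM).
have [a [b [i [j ->]]]] := CpCp_Q8_elt hG x.
by rewrite !uM !uX; do !apply: (QM); apply: QX.
Qed.

Lemma representation_matrix_epi :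
  exists (Phi : {rmorphism hatA O p -> B}) (E : 'I_2 -> 'I_2 -> B)
         (Psi : {rmorphism 'M[hatA O p]_2 -> B}),
    [/\ alg_morphism Phi, forall X, Psi X = \sum_i \sum_j E i j * Phi (X i j),
        forall c, Psi c%:M = Phi c & forall b, exists X, Psi X = b].
Proof.
have uV x : u x * u x^-1%g = 1 by rewrite -uM mulgV u1.
have uV' x : u x^-1%g * u x = 1 by rewrite -uM mulVg u1.
have uSS : u s * u s = -1 by rewrite -expr2 -uX u_z.
have uTT : u t * u t = -1 by rewrite -expr2 -uX -(CpCpQ8_s2 hG) u_z.
have ghC : (u g - u g^-1%g) * (u h - u h^-1%g) = (u h - u h^-1%g) * (u g - u g^-1%g).
  have uC x y : commute x y -> GRing.comm (u x) (u y).
    by move=> xy; rewrite /GRing.comm -(uM x y) -(uM y x) xy.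
  have gC y : commute g y -> GRing.comm (u g - u g^-1%g) (u y).
    move=> gy; apply: commr_sym; apply: commrB; apply: uC.
      exact: commute_sym.
    exact: commuteV (commute_sym gy).
  by apply: commrB; apply: gC; [exact: gh | exact: commuteV].
have uXV x : (x ^+ p = 1)%g -> u x ^+ p = 1 /\ u x^-1%g ^+ p = 1.
  by move=> xp; rewrite -(uX x p) -(uX x^-1%g p) expgVn xp invg1 u1.
have [ugp ug'p] := uXV g gp; have [uhp uh'p] := uXV h hp.
have swap x y x' : (x * y = x' * x)%g -> u x * u y = u x' * u x.
  by move=> xy; rewrite -(uM x y) -(uM x' x) xy.
exact: (hatA_matrix_epi two_unit iota2 uSS uTT u_ts (uV g) (uV' g) (uV h) (uV' h)
    ugp ug'p uhp uh'p (swap _ _ _ sg) (swap _ _ _ sg') (swap _ _ _ sh)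
    (swap _ _ _ sh') (swap _ _ _ tg) (swap _ _ _ tg') (swap _ _ _ th)
    (swap _ _ _ th') ghC u_gen p_odd).
Qed.

End Representation.

Section Block.
Variables (O : idomainType) (p : nat) (gT : finGroupType) (g h s t : gT).
Hypotheses (two_unit : (2 : O) \is a GRing.unit) (hG : CpCp_Q8 p g h s t).
Hypotheses (p_prime : prime p) (p_odd : odd p).
Variable iota : O.
Hypothesis iota2 : iota * iota = -1.

Let he := nonprincipal_idemP two_unit hG.
Local Notation B := (block_alg he).
Local Notation e := (nonprincipal_idem O s).
Let u (x : gT) : B := block_proj he (mon_elt x).

Let uM x y : u (x * y)%g = u x * u y.
Proof. by rewrite /u mon_eltM (rmorphM (block_proj he)). Qed.
Let u1 : u 1%g = 1. Proof. exact: (rmorph1 (block_proj he)). Qed.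
Let z : group_alg O gT := mon_elt (s ^+ 2)%g.

Let zE : z = 1 - (e + e).
Proof.
rewrite -mulr2n -scaler_nat scalerA divrr // scale1r opprB addrC subrK //.
Qed.

Let ze : z * e = - e.
Proof.
have zz : z * z = 1 by rewrite -mon_eltM -expgD (CpCpQ8_s4 hG).
by rewrite /nonprincipal_idem -scalerAr mulrBr mulr1 zz -scalerN opprB.
Qed.

Let zq : z * (1 - e) = 1 - e.
Proof. by rewrite mulrBr mulr1 ze opprK {1}zE opprD addrA subrK. Qed.

Let u_z : u (s ^+ 2)%g = -1.
Proof. by apply: val_inj; rewrite /= -[mon_elt _]/z ze. Qed.

Let block_span (Q : B -> Prop) :
  (forall a, Q (algmap a)) ->
  (forall v w, Q v -> Q w -> Q (v + w)) ->
  (forall v w, Q v -> Q w -> Q (v * w)) ->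
  (forall x, Q (u x)) -> forall b, Q b.
Proof.
move=> Qa QD QM Qu b; rewrite -[b]block_valK.
elim/mon_algW: (val b) => [|v w IHv IHw|c m].
- by rewrite (rmorph0 (block_proj he)) -(rmorph0 algmap).
- by rewrite (rmorphD (block_proj he)); apply: QD.
have -> : (<< c *g m >> : group_alg O gT) = algmap c * mon_elt m.
  by rewrite [RHS]mon_mulUU mulr1 mul1g.
by rewrite (rmorphM (block_proj he)); apply: (QM); [apply: Qa | apply: Qu].
Qed.

Let J1 := ('I_2 * 'I_2 * ('I_p * 'I_p))%type.
Let J2 := ('I_p * 'I_p * ('I_2 * 'I_2))%type.

Let cardJ : #|{: J1 + J2}| = #|gT|.
Proof. by rewrite (CpCp_Q8_card hG) card_sum !card_prod !card_ord; lia. Qed.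

Let coset_elt (j : J2) : gT :=
  (g ^+ j.1.1 * h ^+ j.1.2 * (s ^+ j.2.1 * t ^+ j.2.2))%g.

Let complement_span (x : group_alg O gT) : exists c : J2 -> O,
  x * (1 - e) = \sum_j c j *: (mon_elt (coset_elt j) * (1 - e)).
Proof.
elim/mon_algW: x => [|v w [c cE] [d dE]|a m].
- by exists (fun _ => 0); rewrite mul0r big1 // => j _; rewrite scale0r.
- exists (fun j => c j + d j); rewrite mulrDl cE dE -big_split.
  by apply: eq_bigr => j _; rewrite scalerDl.
have [k [l [i [j mE]]]] := CpCp_Q8_elt hG m.
have zX n (v : group_alg O gT) : v * mon_elt ((s ^+ 2) ^+ n)%g * (1 - e) = v * (1 - e).
  elim: n => [|n IHn]; first by rewrite mulr1.
  by rewrite expgSr mon_eltM mulrA -mulrA [_ * (1 - e)]zq.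
(* z = s^2 = t^2 fixes 1 - e, so exponents of s and t count modulo 2 only *)
have stE : (s ^+ i * t ^+ j =
    s ^+ (i %% 2) * t ^+ (j %% 2) * (s ^+ 2) ^+ (i %/ 2 + j %/ 2))%g.
  rewrite {1}(divn_eq i 2) {1}(divn_eq j 2) ![(_ * 2 + _)%N]addnC !expgD.
  rewrite ![(_ * 2)%N]mulnC !(expgM _ 2) -(CpCpQ8_s2 hG) !mulgA; congr (_ * _)%g.
  rewrite -!mulgA; congr (_ * _)%g; apply/commute_sym/commuteX/commute_sym.
  apply/commuteX; exact: (CpCp_Q8_central hG).
have p_gt0 := prime_gt0 p_prime.
pose j0 : J2 := ((Ordinal (ltn_pmod k p_gt0), Ordinal (ltn_pmod l p_gt0)),
  (Ordinal (ltn_pmod i (isT : 0 < 2)%N), Ordinal (ltn_pmod j (isT : 0 < 2)%N))).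
have gmod n : (g ^+ (n %% p) = g ^+ n)%g by rewrite -(CpCpQ8_order_g hG) expg_mod_order.
have hmod n : (h ^+ (n %% p) = h ^+ n)%g by rewrite -(CpCpQ8_order_h hG) expg_mod_order.
exists (fun j => a *+ (j == j0)); rewrite (bigD1 j0) //= eqxx mulr1n.
rewrite big1 ?addr0 => [|j1 /negPf ->]; last by rewrite scale0r.
have -> : (<< a *g m >> : group_alg O gT) = a *: mon_elt m.
  by rewrite -mon_constZ [RHS]mon_mulUU mulr1 mul1g.
rewrite -scalerAl; congr (_ *: _).
by rewrite /coset_elt /= gmod hmod mE stE mulgA mon_eltM zX.
Qed.

(** It remains to see that the map of [hatA_matrix_epi] is injective.  The
    4 p^2 elements E_ij gamma^a delta^b span M_2(hatA), so their images span
    the block; 4 p^2 elements (indexed by J2) span the complementary block.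
    Together they span O G, which is free of rank 8 p^2, so they are
    linearly independent. *)
Lemma nonprincipal_block_morita : morita_equivalent B (hatA O p).
Proof.
have [Phi [E [Psi [Phi_alg PsiE PsiC Psi_onto]]]] :=
  representation_matrix_epi two_unit hG p_odd iota2 u1 uM u_z block_span.
pose gam := pres_var (@hatA_rel O p) ord0.
pose del := pres_var (@hatA_rel O p) ord_max.
have coord (c : hatA O p) : exists d : 'I_p -> 'I_p -> O,
    c = \sum_i \sum_j algmap (d i j) * (gam ^+ i * del ^+ j).
  have [c' [gamp delp]] := hatA_pow O p_prime.
  exact: (anticomm_coord (@pres_ind2 _ (@hatA_rel O p)) (del_gam O p) gamp delp
    (prime_gt0 p_prime)).
have coordM (X : 'M[hatA O p]_2) : exists d : 'I_2 * 'I_2 * ('I_p * 'I_p) -> O,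
    forall i j, X i j =
      \sum_k \sum_l algmap (d ((i, j), (k, l))) * (gam ^+ k * del ^+ l).
  have /fin_all_exists[d dE] := fun ij : 'I_2 * 'I_2 => coord (X ij.1 ij.2).
  by exists (fun q => d q.1 q.2.1 q.2.2) => i j; rewrite (dE (i, j)).
pose w (q : J1) : group_alg O gT :=
  val (E q.1.1 q.1.2 * Phi (gam ^+ q.2.1 * del ^+ q.2.2)).
have valPsi (X : 'M[hatA O p]_2) (d : J1 -> O) :
    (forall i j, X i j = \sum_k \sum_l algmap (d ((i, j), (k, l))) *
      (gam ^+ k * del ^+ l)) ->
  val (Psi X) = \sum_q d q *: w q.
  move=> XE; have -> : Psi X = \sum_q algmap (d q) *
      (E q.1.1 q.1.2 * Phi (gam ^+ q.2.1 * del ^+ q.2.2)).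
    pose F (ij : 'I_2 * 'I_2) (kl : 'I_p * 'I_p) := algmap (d (ij, kl)) *
      (E ij.1 ij.2 * Phi (gam ^+ kl.1 * del ^+ kl.2)).
    rewrite [RHS](eq_bigr (fun q => F q.1 q.2)); last by case.
    rewrite PsiE [LHS]pair_bigA -(pair_bigA _ F).
    apply: eq_bigr => -[i j] _ /=; rewrite XE pair_bigA rmorph_sum mulr_sumr.
    by apply: eq_bigr => -[k l] _ /=; rewrite rmorphM Phi_alg mulrA -algmapC -mulrA.
  rewrite block_val_sum; apply: eq_bigr => q _.
  by rewrite block_val_algmapM -mon_constZ.
pose v (q : J1 + J2) := match q with
  | inl q1 => w q1 | inr q2 => mon_elt (coset_elt q2) * (1 - e) end.
have sum_sum (G : J1 + J2 -> group_alg O gT) :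
    \sum_q G q = \sum_q1 G (inl q1) + \sum_q2 G (inr q2).
  by rewrite big_sumType.
have v_span x : exists c : J1 + J2 -> O, x = \sum_q c q *: v q.
  have [X XE] := Psi_onto (block_proj he x); have [d dE] := coordM X.
  have [c cE] := complement_span x.
  exists (fun q => match q with inl q1 => d q1 | inr q2 => c q2 end).
  rewrite sum_sum /= -cE -(valPsi X d dE) XE /=.
  by rewrite mulrBr mulr1 addrC subrK.
have Psi_inj : injective Psi.
  apply: raddf_inj => X PsiX0; have [d dE] := coordM X.
  have := spanning_free (c := fun q => match q with inl q1 => d q1 | inr _ => 0 end)
    cardJ v_span.
  rewrite sum_sum /= -(valPsi X d dE) PsiX0 big1 => [|q _]; last by rewrite scale0r.
  rewrite addr0 => /(_ erefl) d0; apply/matrixP=> i j; rewrite mxE dE.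
  rewrite big1 // => k _; rewrite big1 // => l _.
  by rewrite (d0 (inl ((i, j), (k, l)))) rmorph0 mul0r.
have [Psi' Psi'K] := choice Psi_onto.
have PsiK : cancel Psi Psi' by move=> X; apply: Psi_inj; rewrite Psi'K.
apply: (matrix_morita_equivalent PsiK Psi'K) => a.
by rewrite PsiC Phi_alg.
Qed.

End Block.

(** * The basic algebra of the nonprincipal block *)

Lemma primitive_root_imaginary (O : idomainType) (p : nat) (zeta : O) :
  (0 < p)%N -> (4 * p).-primitive_root zeta -> zeta ^+ p * zeta ^+ p = -1.
Proof.
move=> p_gt0 z_prim; rewrite -exprD addnn -mul2n.
have : (zeta ^+ (2 * p) - 1) * (zeta ^+ (2 * p) + 1) = 0.
  by rewrite -subr_sqr expr1n -exprM mulnAC (prim_expr_order z_prim) subrr.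
move/eqP; rewrite mulf_eq0 subr_eq0 addr_eq0 -(prim_order_dvd z_prim).
by rewrite dvdn_pmul2r // orFb => /eqP.
Qed.

Theorem theorem1p5 (p : nat) (O : idomainType) (k : fieldType)
    (res : {rmorphism O -> k}) (gT : finGroupType) (g h s t : gT)
    (p_prime : prime p) (p_odd : odd p)
    (O_complete : complete_dvr O) (O_char0 : [pchar O] =i pred0)
    (k_residue : residue_map res) (k_charp : p \in [pchar k])
    (O_root : exists zeta : O, (4 * p)%N.-primitive_root zeta)
    (G_struct : CpCp_Q8 p g h s t) :
  basic_algebra_of
    (nonprincipal_block (residue_unit2 k_residue k_charp p_odd) G_struct)
    (hatA O p) /\
  (exists n : nat,
     alg_iso_prod (quot_alg (@jacobson (hatA O p)))
       (fun _ : 'I_n => restrict res)) /\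
  alg_iso (tensor_alg res (hatA O p)) (algA k p).
Proof.
have [zeta z_prim] := O_root.
have jac := hatA_jacobson_iso p_prime k_charp k_residue.
have iota2 := primitive_root_imaginary (prime_gt0 p_prime) z_prim.
split; [split | split].
- exact: nonprincipal_block_morita iota2.
- by exists 1%N, (fun _ => restrict res); split=> // _; apply: restrict_division_algebra.
- by exists 1%N.
- exact: tensor_hatA_iso.
Qed.
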